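(* Let $M$ be a lightlike hypersurface of an indefinite statistical manifold $(\overline{M},\overline{g},\overline{\nabla},\overline{\nabla}^{*})$, with screen distribution $S(TM)$, radical distribution $\mathrm{Rad}(TM)$ spanned by $\xi$, and induced connections $\nabla$ and $\nabla^{*}$ on $M$. The following assertions are equivalent: (1) $\mathrm{Rad}(TM)$ is parallel with respect to both $\nabla$ and $\nabla^{*}$; (2) $A_{\xi}=A_{\xi}^{*}=0$; (3) $\nabla^{0}$ is a metric connection and $K(X,\xi)\in\Gamma(\mathrm{Rad}(TM))$ for all $X\in\Gamma(TM)$; (4) $B(X,W)=B^{*}(X,W)=0$ for all $X\in\Gamma(TM)$ and $W\in\Gamma(S(TM))$.
   Context: $\Gamma(E)$ denotes smooth sections of $E$. An indefinite statistical manifold $(\overline{M},\overline{g},\overline{\nabla},\overline{\nabla}^{*})$ is a semi-Riemannian manifold $(\overline M,\overline g)$ with a torsion-free affine connection $\overline\nabla$ satisfying the Codazzi condition $(\overline{\nabla}_{X}\overline{g})(Y,Z)=(\overline{\nabla}_{Y}\overline{g})(X,Z)$, together with the dual connection $\overline\nabla^{*}$ determined by $X\overline{g}(Y,Z)=\overline{g}(\overline{\nabla}_{X}Y,Z)+\overline{g}(Y,\overline{\nabla}^{*}_{X}Z)$ (which is then also torsion-free). $M$ is a lightlike hypersurface: $M$ has codimension one and the induced metric $g$ is degenerate, so $\mathrm{Rad}(TM)=TM\cap TM^{\perp}=TM^{\perp}$ is a rank-one bundle. A screen distribution $S(TM)$ is a non-degenerate distribution complementary to $\mathrm{Rad}(TM)$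 in $TM$; one is fixed. Fix a nowhere-zero section $\xi$ of $\mathrm{Rad}(TM)$ (in general it exists only locally, and all objects depending on it are understood on its domain). $N$ is the unique vector field along $M$ with $\overline{g}(N,N)=0$, $\overline{g}(N,\xi)=1$, $\overline{g}(N,W)=0$ for all $W\in\Gamma(S(TM))$; then $T\overline M|_M=TM\oplus\mathrm{span}\{N\}$. For $X,Y\in\Gamma(TM)$ the Gauss formulas $\overline{\nabla}_{X}Y=\nabla_{X}Y+B(X,Y)N$ and $\overline{\nabla}^{*}_{X}Y=\nabla^{*}_{X}Y+B^{*}(X,Y)N$, with $\nabla_XY,\nabla^*_XY\in\Gamma(TM)$, define the induced torsion-free connections $\nabla,\nabla^{*}$ and the symmetric second fundamental forms $B,B^{*}$. The screen-valued operators $A_{\xi},A_{\xi}^{*}:TM\to S(TM)$ and one-forms $\tau,\tau^{*}$ are defined by $\nabla_{X}\xi=-A_{\xi}X-\tau(X)\xi$ and $\nabla^{*}_{X}\xi=-A^{*}_{\xi}X-\tau^{*}(X)\xi$. Put $\nabla^{0}=\frac12(\nabla+\nabla^{*})$ and $K(X,Y)=\frac12(\nabla_XY-\nabla^{*}_XY)$. A connection $D$ on $M$ is called a metric connection if $Dg=0$. A distribution $\mathcal D$ on $M$ is parallel with respect to a connection $D$ if $D_XY\in\Gamma(\mathcal D)$ for all $X\in\Gamma(TM)$, $Y\in\Gamma(\mathcal D)$. *)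

(* Defs.v *)
From mathcomp Require Import all_boot all_order all_algebra.
From mathcomp Require Import all_classical all_reals all_analysis.

Set Implicit Arguments.
Unset Strict Implicit.
Unset Printing Implicit Defensive.

Import Order.TTheory GRing.Theory Num.Theory.
Import numFieldNormedType.Exports.

Local Open Scope classical_set_scope.
Local Open Scope ring_scope.

(** * Smooth manifolds *)

(* [f] is of class C^k on the open set [U].  Between finite-dimensional spaces
   the map [x |-> 'd f x] is C^k iff each [x |-> 'd f x v] is. *)
Fixpoint Ck (R : realType) (V W : normedModType R) (k : nat) (U : set V)
    (f : V -> W) : Prop :=
  if k is k'.+1 then
    (forall x, U x -> differentiable f x) /\
    (forall v : V, Ck k' U (fun x => 'd f x v : W))
  else forall x, U x -> {for x, continuous f}.

Definition smooth_on (R : realType) (V W : normedModType R) (U : set V)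
    (f : V -> W) : Prop := forall k, Ck k U f.

(* [cinv] is only meaningful on the open set [cmap @` cdom]. *)
Record chart (R : realType) (n : nat) (T : topologicalType) := Chart {
  cdom : set T;
  cmap : T -> 'rV[R]_n;
  cinv : 'rV[R]_n -> T;
  cdom_open : open cdom;
  cimg_open : open (cmap @` cdom);
  cmapK : forall p, cdom p -> cinv (cmap p) = p;
  cmap_continuous : forall p, cdom p -> {for p, continuous cmap};
  cinv_continuous : forall x, (cmap @` cdom) x -> {for x, continuous cinv} }.

(* The atlas is indexed by the points: [chart_at p] is a chart around [p]. *)
Record manifold (R : realType) (n : nat) := Manifold {
  carrier :> topologicalType;
  chart_at : carrier -> chart R n carrier;
  mem_chart_at : forall p, cdom (chart_at p) p;
  chart_compat : forall p q,
    smooth_on (cmap (chart_at p) @` (cdom (chart_at p) `&` cdom (chart_at q)))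
      (cmap (chart_at q) \o cinv (chart_at p));
  carrier_hausdorff : hausdorff_space carrier;
  carrier_second_countable : @second_countable carrier }.

(* The tangent space at [p] is ['rV[R]_n], a row vector being read as the
   components of a tangent vector in the chart [chart_at p].  A vector field is
   therefore a function [M -> 'rV[R]_n], but its components in one fixed chart
   are obtained through [coord_change] below. *)

Section Manifolds.
Context {R : realType}.

Definition smooth_fun {n} {M : manifold R n} (f : M -> R) : Prop :=
  forall p : M, smooth_on (cmap (chart_at p) @` cdom (chart_at p))
    (f \o cinv (chart_at p)).

Definition smooth_map {m n} {M : manifold R m} {N : manifold R n}
    (F : M -> N) : Prop :=
  continuous F /\
  forall (p : M) (q : N),
    smooth_on
      (cmap (chart_at p) @` (cdom (chart_at p) `&` F @^-1` cdom (chart_at q)))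
      (cmap (chart_at q) \o F \o cinv (chart_at p)).

(* the components in the chart [chart_at q] of a tangent vector [v] at [r] *)
Definition coord_change {n} {M : manifold R n} (q r : M) (v : 'rV[R]_n)
    : 'rV[R]_n :=
  'd (cmap (chart_at q) \o cinv (chart_at r)) (cmap (chart_at r) r) v.

Definition tangent_map {m n} {M : manifold R m} {N : manifold R n}
    (F : M -> N) (p : M) (v : 'rV[R]_m) : 'rV[R]_n :=
  'd (cmap (chart_at (F p)) \o F \o cinv (chart_at p)) (cmap (chart_at p) p) v.

(* the derivative [v f] of the function [f] along a tangent vector [v] at [p] *)
Definition dirder {n} {M : manifold R n} (f : M -> R) (p : M) (v : 'rV[R]_n)
    : R :=
  'd (f \o cinv (chart_at p)) (cmap (chart_at p) p) v.

(* [V], with [V p] tangent to [N] at [F p], is smooth on the open set [U]. *)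
Definition smooth_field_along {m n} {M : manifold R m} {N : manifold R n}
    (U : set M) (F : M -> N) (V : M -> 'rV[R]_n) : Prop :=
  forall (p : M) (q : N),
    smooth_on
      (cmap (chart_at p) @`
         (cdom (chart_at p) `&` U `&` F @^-1` cdom (chart_at q)))
      (fun x => let r := cinv (chart_at p) x in coord_change q (F r) (V r)).

Definition sections_along {m n} {M : manifold R m} {N : manifold R n}
    (F : M -> N) : set (M -> 'rV[R]_n) := smooth_field_along setT F.

Definition vector_fields {n} (M : manifold R n) : set (M -> 'rV[R]_n) :=
  sections_along (@id M).
Arguments vector_fields {n} M _.

(** * Connections *)

(* A connection on the pullback [F^* TN], in the sense of Koszul.  Operators on
   fields are total functions; only their values on smooth fields matter. *)
Record connection_along {m n} {M : manifold R m} {N : manifold R n}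
    (F : M -> N)
    (D : (M -> 'rV[R]_m) -> (M -> 'rV[R]_n) -> (M -> 'rV[R]_n)) : Prop :=
  ConnectionAlong {
  conn_smooth : forall X V, vector_fields M X -> sections_along F V ->
    sections_along F (D X V);
  conn_addl : forall X Y V,
    vector_fields M X -> vector_fields M Y -> sections_along F V ->
    D (fun p => X p + Y p) V = (fun p => D X V p + D Y V p);
  conn_scalel : forall f X V,
    smooth_fun f -> vector_fields M X -> sections_along F V ->
    D (fun p => f p *: X p) V = (fun p => f p *: D X V p);
  conn_addr : forall X V W,
    vector_fields M X -> sections_along F V -> sections_along F W ->
    D X (fun p => V p + W p) = (fun p => D X V p + D X W p);
  conn_leibniz : forall f X V,
    smooth_fun f -> vector_fields M X -> sections_along F V ->
    D X (fun p => f p *: V p) =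
      (fun p => dirder f p (X p) *: V p + f p *: D X V p) }.

Definition affine_connection {n} (M : manifold R n)
    (D : (M -> 'rV[R]_n) -> (M -> 'rV[R]_n) -> (M -> 'rV[R]_n)) : Prop :=
  connection_along (@id M) D.

(* [D X Y - D Y X = [X, Y]], the bracket being given by its action on
   functions. *)
Definition torsion_free {n} (M : manifold R n)
    (D : (M -> 'rV[R]_n) -> (M -> 'rV[R]_n) -> (M -> 'rV[R]_n)) : Prop :=
  forall X Y f, vector_fields M X -> vector_fields M Y -> smooth_fun f ->
  forall p, dirder f p (D X Y p - D Y X p) =
    dirder (fun q => dirder f q (Y q)) p (X p) -
    dirder (fun q => dirder f q (X q)) p (Y p).

(* [D] is the connection along [F] induced by [nabla]: it is determined by its
   values on the fields [Z \o F], since these generate locally all the fields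
   along [F]. *)
Definition pullback_connection {m n} {M : manifold R m} {N : manifold R n}
    (F : M -> N)
    (nabla : (N -> 'rV[R]_n) -> (N -> 'rV[R]_n) -> (N -> 'rV[R]_n))
    (D : (M -> 'rV[R]_m) -> (M -> 'rV[R]_n) -> (M -> 'rV[R]_n)) : Prop :=
  connection_along F D /\
  forall X Y Z p,
    vector_fields M X -> vector_fields N Y -> vector_fields N Z ->
    Y (F p) = tangent_map F p (X p) ->
    D X (Z \o F) p = nabla Y Z (F p).

(** * Metrics and statistical structures *)

Definition negative_definite_on {n} (b : 'rV[R]_n -> 'rV[R]_n -> R) {k}
    (A : 'M[R]_(k, n)) : Prop :=
  forall u : 'rV[R]_k, u != 0 -> b (u *m A) (u *m A) < 0.

(* [k] is the maximal dimension of a negative definite subspace *)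
Definition has_index {n} (b : 'rV[R]_n -> 'rV[R]_n -> R) (k : nat) : Prop :=
  (exists A : 'M[R]_(k, n), negative_definite_on b A) /\
  (forall l (A : 'M[R]_(l, n)), negative_definite_on b A -> (l <= k)%N).

Record semi_riemannian {n} {M : manifold R n}
    (g : M -> 'rV[R]_n -> 'rV[R]_n -> R) : Prop := SemiRiemannian {
  metric_linear : forall p a u v w,
    g p (a *: u + v) w = a * g p u w + g p v w;
  metric_sym : forall p v w, g p v w = g p w v;
  metric_smooth : forall X Y, vector_fields M X -> vector_fields M Y ->
    smooth_fun (fun p => g p (X p) (Y p));
  metric_nondegenerate : forall p v, (forall w, g p v w = 0) -> v = 0;
  metric_index : exists k, forall p, has_index (g p) k }.

(* [(D_X g)(Y, Z)] *)
Definition cov_deriv {n} {M : manifold R n}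
    (D : (M -> 'rV[R]_n) -> (M -> 'rV[R]_n) -> (M -> 'rV[R]_n))
    (g : M -> 'rV[R]_n -> 'rV[R]_n -> R) (X Y Z : M -> 'rV[R]_n) (p : M) : R :=
  dirder (fun q => g q (Y q) (Z q)) p (X p)
  - g p (D X Y p) (Z p) - g p (Y p) (D X Z p).

Definition metric_connection {n} {M : manifold R n}
    (g : M -> 'rV[R]_n -> 'rV[R]_n -> R)
    (D : (M -> 'rV[R]_n) -> (M -> 'rV[R]_n) -> (M -> 'rV[R]_n)) : Prop :=
  forall X Y Z, vector_fields M X -> vector_fields M Y -> vector_fields M Z ->
  forall p, cov_deriv D g X Y Z p = 0.

Definition codazzi {n} {M : manifold R n}
    (g : M -> 'rV[R]_n -> 'rV[R]_n -> R)
    (D : (M -> 'rV[R]_n) -> (M -> 'rV[R]_n) -> (M -> 'rV[R]_n)) : Prop :=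
  forall X Y Z, vector_fields M X -> vector_fields M Y -> vector_fields M Z ->
  forall p, cov_deriv D g X Y Z p = cov_deriv D g Y X Z p.

Definition dual_connections {n} {M : manifold R n}
    (g : M -> 'rV[R]_n -> 'rV[R]_n -> R)
    (D D' : (M -> 'rV[R]_n) -> (M -> 'rV[R]_n) -> (M -> 'rV[R]_n)) : Prop :=
  forall X Y Z, vector_fields M X -> vector_fields M Y -> vector_fields M Z ->
  forall p, dirder (fun q => g q (Y q) (Z q)) p (X p) =
    g p (D X Y p) (Z p) + g p (Y p) (D' X Z p).

Record statistical_manifold {n} {M : manifold R n}
    (g : M -> 'rV[R]_n -> 'rV[R]_n -> R)
    (D D' : (M -> 'rV[R]_n) -> (M -> 'rV[R]_n) -> (M -> 'rV[R]_n)) : Prop :=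
  StatisticalManifold {
  stat_metric : semi_riemannian g;
  stat_connection : affine_connection D;
  stat_torsion_free : torsion_free D;
  stat_codazzi : codazzi g D;
  stat_dual_connection : affine_connection D';
  stat_dual : dual_connections g D D' }.

(** * Distributions *)

(* [S p] is the subspace of the tangent space at [p] given by a smooth
   distribution of rank [r]: locally [S] has a smooth frame [E]. *)
Definition smooth_distribution {n} {M : manifold R n} (r : nat)
    (S : M -> set 'rV[R]_n) : Prop :=
  forall p, exists (U : set M) (E : 'I_r -> M -> 'rV[R]_n),
    [/\ open U, U p, forall j, smooth_field_along U (@id M) (E j) &
      forall q, U q ->
        row_free (\matrix_(j < r) E j q) /\
        forall v, S q v <-> (v <= \matrix_(j < r) E j q)%MS].

Definition sections {n} {M : manifold R n} (S : M -> set 'rV[R]_n)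
    : set (M -> 'rV[R]_n) :=
  [set X | vector_fields M X /\ forall p, S p (X p)].

Definition parallel {n} {M : manifold R n}
    (D : (M -> 'rV[R]_n) -> (M -> 'rV[R]_n) -> (M -> 'rV[R]_n))
    (S : M -> set 'rV[R]_n) : Prop :=
  forall X Y, vector_fields M X -> sections S Y -> sections S (D X Y).

(** * Lightlike hypersurfaces *)

Definition immersion {m n} {M : manifold R m} {N : manifold R n}
    (F : M -> N) : Prop :=
  smooth_map F /\ forall p, injective (tangent_map F p).

Definition induced_metric {m n} {M : manifold R m} {N : manifold R n}
    (F : M -> N) (g : N -> 'rV[R]_n -> 'rV[R]_n -> R)
    : M -> 'rV[R]_m -> 'rV[R]_m -> R :=
  fun p v w => g (F p) (tangent_map F p v) (tangent_map F p w).

(* the tangent vectors [v] of [M] with [dF v] orthogonal to [dF (T_p M)] *)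
Definition Rad {m n} {M : manifold R m} {N : manifold R n}
    (F : M -> N) (g : N -> 'rV[R]_n -> 'rV[R]_n -> R) (p : M)
    : set 'rV[R]_m :=
  [set v | forall w, induced_metric F g p v w = 0].

Definition lightlike_hypersurface {n} {M : manifold R n}
    {Mb : manifold R n.+1} (i : M -> Mb)
    (gb : Mb -> 'rV[R]_n.+1 -> 'rV[R]_n.+1 -> R) : Prop :=
  immersion i /\ forall p, exists2 v, Rad i gb p v & v != 0.

Record screen_distribution {n} {M : manifold R n} {Mb : manifold R n.+1}
    (i : M -> Mb) (gb : Mb -> 'rV[R]_n.+1 -> 'rV[R]_n.+1 -> R)
    (S : M -> set 'rV[R]_n) : Prop := ScreenDistribution {
  screen_smooth : exists r, smooth_distribution r S;
  screen_nondegenerate : forall p v, S p v ->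
    (forall w, S p w -> induced_metric i gb p v w = 0) -> v = 0;
  screen_direct : forall p v, Rad i gb p v -> S p v -> v = 0;
  screen_full : forall p v,
    exists u w, [/\ Rad i gb p u, S p w & v = u + w] }.

Definition radical_generator {n} {M : manifold R n} {Mb : manifold R n.+1}
    (i : M -> Mb) (gb : Mb -> 'rV[R]_n.+1 -> 'rV[R]_n.+1 -> R)
    (xi : M -> 'rV[R]_n) : Prop :=
  sections (Rad i gb) xi /\ forall p, xi p != 0.

Record lightlike_transversal {n} {M : manifold R n} {Mb : manifold R n.+1}
    (i : M -> Mb) (gb : Mb -> 'rV[R]_n.+1 -> 'rV[R]_n.+1 -> R)
    (S : M -> set 'rV[R]_n) (xi : M -> 'rV[R]_n) (N : M -> 'rV[R]_n.+1)
    : Prop := LightlikeTransversal {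
  transversal_smooth : sections_along i N;
  transversal_null : forall p, gb (i p) (N p) (N p) = 0;
  transversal_radical : forall p,
    gb (i p) (N p) (tangent_map i p (xi p)) = 1;
  transversal_screen : forall p w, S p w ->
    gb (i p) (N p) (tangent_map i p w) = 0 }.

(* [Db_X Y = D_X Y + B(X, Y) N], [Db] being the connection along [i] induced by
   that of the ambient manifold *)
Definition gauss_formula {n} {M : manifold R n} {Mb : manifold R n.+1}
    (i : M -> Mb) (N : M -> 'rV[R]_n.+1)
    (Db : (M -> 'rV[R]_n) -> (M -> 'rV[R]_n.+1) -> (M -> 'rV[R]_n.+1))
    (D : (M -> 'rV[R]_n) -> (M -> 'rV[R]_n) -> (M -> 'rV[R]_n))
    (B : (M -> 'rV[R]_n) -> (M -> 'rV[R]_n) -> (M -> R)) : Prop :=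
  forall X Y, vector_fields M X -> vector_fields M Y ->
  [/\ vector_fields M (D X Y), smooth_fun (B X Y) &
    forall p, Db X (fun q => tangent_map i q (Y q)) p =
      tangent_map i p (D X Y p) + B X Y p *: N p].

(* [D_X xi = - A X - tau(X) xi] with [A] screen-valued *)
Definition radical_weingarten {n} {M : manifold R n}
    (S : M -> set 'rV[R]_n) (xi : M -> 'rV[R]_n)
    (D : (M -> 'rV[R]_n) -> (M -> 'rV[R]_n) -> (M -> 'rV[R]_n))
    (A : (M -> 'rV[R]_n) -> (M -> 'rV[R]_n))
    (tau : (M -> 'rV[R]_n) -> (M -> R)) : Prop :=
  forall X, vector_fields M X ->
  [/\ sections S (A X), smooth_fun (tau X) &
    forall p, D X xi p = - A X p - tau X p *: xi p].

Definition mean_connection {n} {M : manifold R n}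
    (D D' : (M -> 'rV[R]_n) -> (M -> 'rV[R]_n) -> (M -> 'rV[R]_n))
    (X Y : M -> 'rV[R]_n) : M -> 'rV[R]_n :=
  fun p => 2^-1 *: (D X Y p + D' X Y p).

Definition difference_tensor {n} {M : manifold R n}
    (D D' : (M -> 'rV[R]_n) -> (M -> 'rV[R]_n) -> (M -> 'rV[R]_n))
    (X Y : M -> 'rV[R]_n) : M -> 'rV[R]_n :=
  fun p => 2^-1 *: (D X Y p - D' X Y p).

End Manifolds.

Arguments vector_fields {R n} M _.

(* Main.v *)
(* Write eta Z = gb(N, Z).  Duality of the ambient connections passes to the
   fields along the immersion, and the Gauss formulas turn it into
     X g(Y, Z) = g(nabla_X Y, Z) + B(X, Y) eta Z
                 + g(Y, nabla'_X Z) + B'(X, Z) eta Y,                     (D)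
   from which everything is read off.  For Y in Rad(TM) the left-hand side and
   the term g(Y, -) vanish, so
     g(nabla_X Y, Z) = - B(X, Y) eta Z - B'(X, Z) eta Y;
   with Y = xi and Z in the screen, g(A_xi X, Z) = B'(X, Z).  Adding (D) to
   itself with Y and Z exchanged shows that nabla^0 is metric iff
   (B + B')(X, Y) eta Z + (B + B')(X, Z) eta Y = 0.
   The pullback connections are characterised only on restrictions of globally
   defined ambient fields, so (D) needs bump functions: near a given point any
   field along the immersion is, up to a nonvanishing smooth factor, a
   combination with smooth coefficients of such restrictions. *)
From HB Require Import structures.
Require Import Defs.
From mathcomp Require Import all_boot all_order all_algebra.
From mathcomp Require Import all_classical all_reals all_analysis.
From mathcomp Require Import ring lra.
Set Implicit Arguments.
Unset Strict Implicit.
Unset Printing Implicit Defensive.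
Import Order.TTheory GRing.Theory Num.Theory.
Import numFieldNormedType.Exports.
Local Open Scope classical_set_scope.
Local Open Scope ring_scope.

(** * Calculus of C^k maps *)

Section Differential.
Context {R : realType} {V W : normedModType R}.

(** The first-order expansion of [f] at [x] is also one of [g], and [diff_unique] identifies the
    differentials. Chart expressions often agree only near a point, so equality as functions would
    be too strong to ask. *)
Lemma near_eq_diff (f g : V -> W) (x : V) : (\near x, f x = g x) ->
  differentiable f x -> differentiable g x /\ forall v, 'd g x v = 'd f x v.
Proof.
move=> fg df.
have fgx : f x = g x by exact: nbhs_singleton fg.
have E : g \o shift x = cst (g x) + 'd f x +o_ 0 id.
  apply/eqaddoP => e e0.
  have /eqaddoP/(_ e e0) := diff_locally df.
  move: fg; rewrite (near_shift 0) => fg; apply: filterS2 fg => h /=.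
  by rewrite subr0 !fctE /cst /= fgx => ->.
have dg := diff_unique (diff_continuous df) E; split=> [|v]; last by rewrite dg.
by apply/diff_locallyP; rewrite dg; split => //; exact: diff_continuous.
Qed.

(* [scale_continuous] is stated for scalars in [R^o]. *)
Lemma scale_pair_continuous : continuous (fun p : R * W => p.1 *: p.2).
Proof. by move=> p; apply: scale_continuous. Qed.

Lemma scale_is_bilinear : bilinear_for
    (GRing.Scale.Law.clone _ _ *:%R _) (GRing.Scale.Law.clone _ _ *:%R _)
    (@GRing.scale R W).
Proof.
split=> [u|u] a x y /=; first by rewrite scalerDl scalerA.
by rewrite scalerDr !scalerA mulrC.
Qed.

HB.instance Definition _ :=
  bilinear_isBilinear.Build R R W W _ _ (@GRing.scale R W) scale_is_bilinear.

Lemma is_diff_scale (f : V -> R) (g : V -> W) (x : V) :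
  differentiable f x -> differentiable g x ->
  differentiable (fun y => f y *: g y) x /\
  forall v, 'd (fun y => f y *: g y) x v = f x *: 'd g x v + 'd f x v *: g x.
Proof.
move=> df dg.
have dp := differentiable_pair df dg.
pose sc : {bilinear R -> W -> W} := @GRing.scale R W.
have ds : differentiable (fun p : R * W => p.1 *: p.2) (f x, g x).
  exact: (@differentiable_bilin _ _ _ _ sc (f x, g x) scale_pair_continuous).
split=> [|v]; first exact: (differentiable_comp dp ds).
have -> := congr1 (@^~ v) (diff_comp dp ds); rewrite /= (diff_pair df dg).
by rewrite (@diff_bilin _ _ _ _ sc (f x, g x) scale_pair_continuous).
Qed.

End Differential.

(** * Closure properties of C^k maps, up to composition *)

Section CkTheory.
Context {R : realType}.
Implicit Types V W : normedModType R.

Lemma Ck_sub V W k (U U' : set V) (f : V -> W) :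
  U' `<=` U -> Ck k U f -> Ck k U' f.
Proof.
move=> UU; elim: k f => [|k IH] f /=; first by move=> h x /UU /h.
by case=> h1 h2; split=> [x /UU /h1|v]; [|exact: IH].
Qed.

(** Each clause of [Ck] is a condition at the points of the set, with continuity and
    differentiability taken in the whole space; hence the sets [U'] need not be open. *)
Lemma Ck_local V W k (U : set V) (f : V -> W) :
  (forall x, U x -> exists2 U', U' x & Ck k U' f) -> Ck k U f.
Proof.
elim: k f => [|k IH] f /= h; first by move=> x /h[U' U'x]; exact.
split=> [x /h[U' U'x [h1 _]]|v]; first exact: h1.
by apply: IH => x /h[U' U'x [_ h2]]; exists U'.
Qed.

Lemma eq_Ck V W k (U : set V) (f g : V -> W) : open U ->
  (forall x, U x -> f x = g x) -> Ck k U f -> Ck k U g.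
Proof.
move=> oU; elim: k f g => [|k IH] f g fg /=.
  move=> h x Ux; have Un : nbhs x U by exact: open_nbhs_nbhs.
  rewrite /prop_for /continuous_at -fg //; apply: cvg_trans (h x Ux).
  by apply: near_eq_cvg; apply: filterS Un => y /fg.
have fgn x : U x -> \near x, f x = g x.
  by move=> Ux; apply: filterS (open_nbhs_nbhs (conj oU Ux)) => y /fg.
move=> [h1 h2]; split=> [x Ux|v].
  by have [] := near_eq_diff (fgn x Ux) (h1 x Ux).
apply: IH (h2 v) => x Ux; by have [_ ->] := near_eq_diff (fgn x Ux) (h1 x Ux).
Qed.

Lemma CkW V W k (U : set V) (f : V -> W) : Ck k.+1 U f -> Ck k U f.
Proof.
elim: k f => [|k IH] f.
  by move=> [h _] x /h; exact: differentiable_continuous.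
by move=> [h1 h2]; split=> // v; exact: IH (h2 v).
Qed.

Lemma Ck_cst V W k (U : set V) (c : W) : Ck k U (fun=> c : W).
Proof.
elim: k c => [|k IH] c /=; first by move=> x _; exact: cst_continuous.
split=> [x _|v]; first exact: differentiable_cst.
by rewrite (_ : (fun x => _) = fun=> 0) //; apply/funext => x; rewrite diff_cst.
Qed.

Lemma Ck_add V W k (U : set V) (f g : V -> W) : open U ->
  Ck k U f -> Ck k U g -> Ck k U (fun x => f x + g x).
Proof.
move=> oU; elim: k f g => [|k IH] f g /=.
  by move=> hf hg x Ux; apply: cvgD; [exact: hf|exact: hg].
move=> [f1 f2] [g1 g2]; split=> [x Ux|v].
  by apply: differentiableD; [exact: f1|exact: g1].
apply: eq_Ck (IH _ _ (f2 v) (g2 v)) => // x Ux /=.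
exact: esym (congr1 (@^~ v) (diffD (f1 x Ux) (g1 x Ux))).
Qed.

Lemma Ck_sum V W k (U : set V) (I : Type) (r : seq I) (P : pred I)
    (f : I -> V -> W) : open U ->
  (forall i, Ck k U (f i)) -> Ck k U (fun x => \sum_(i <- r | P i) f i x).
Proof.
move=> oU h; elim: r => [|i r IH].
  rewrite (_ : (fun x => _) = fun=> 0); first exact: Ck_cst.
  by apply/funext => x; rewrite big_nil.
case Pi : (P i); last first.
  rewrite (_ : (fun x => _) = fun x => \sum_(i <- r | P i) f i x) //.
  by apply/funext => x; rewrite big_cons Pi.
rewrite (_ : (fun x => _) = fun x => f i x + \sum_(i <- r | P i) f i x).
  exact: Ck_add.
by apply/funext => x; rewrite big_cons Pi.
Qed.

Lemma Ck_scale V W k (U : set V) (f : V -> R) (g : V -> W) : open U ->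
  Ck k U f -> Ck k U g -> Ck k U (fun x => f x *: g x).
Proof.
move=> oU; elim: k f g => [|k IH] f g.
  by move=> hf hg x Ux; apply: cvgZ; [exact: hf|exact: hg].
move=> cf cg; have [f1 f2] := cf; have [g1 g2] := cg; split=> [x Ux|v].
  by have [] := is_diff_scale (f1 x Ux) (g1 x Ux).
apply: (@eq_Ck _ _ _ _ (fun x => f x *: 'd g x v + 'd f x v *: g x)) => //.
  by move=> x Ux; have [_ ->] := is_diff_scale (f1 x Ux) (g1 x Ux).
(* Each term of the product rule keeps one factor undifferentiated; [CkW] lowers that factor to
   order k. *)
apply: Ck_add => //; apply: IH; [exact: CkW|exact: g2|exact: f2|exact: CkW].
Qed.

Lemma Ck_linear V V' W k (U : set V) (l : {linear V' -> W}) (f : V -> V') :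
  open U -> continuous l -> Ck k U f -> Ck k U (l \o f).
Proof.
move=> oU lc; elim: k f => [|k IH] f.
  by move=> h x Ux; apply: continuous_comp; [exact: h|exact: lc].
move=> [h1 h2]; have dl y := linear_differentiable y lc.
split=> [x Ux|v]; first exact: (differentiable_comp (h1 x Ux)).
apply: eq_Ck (IH _ (h2 v)) => // x Ux /=.
by have -> := congr1 (@^~ v) (diff_comp (h1 x Ux) (dl _)); rewrite /= diff_lin.
Qed.

(** Finite dimensionality in the form used below: a finite spanning family with continuous linear
    coefficients. Stated abstractly, it covers both row vectors and the scalar field. *)
Record coordinates V m (e : 'I_m -> V) (l : 'I_m -> {linear V -> R}) :=
  Coordinates {
  coord_cont : forall j, continuous (l j);
  coord_sum : forall u, u = \sum_j l j u *: e j }.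

(** [Ck] controls a differential only on fixed vectors. Expanding [u x] in coordinates turns
    [L x (u x)] into a finite sum of scalar functions times such values, which allows a varying
    argument. *)
Lemma Ck_apply V V' W m (e : 'I_m -> V') (l : 'I_m -> {linear V' -> R})
    k (U : set V) (L : V -> {linear V' -> W}) (u : V -> V') :
  coordinates e l -> open U -> (forall v, Ck k U (fun x => L x v)) ->
  Ck k U u -> Ck k U (fun x => L x (u x)).
Proof.
move=> [lc ls] oU cL cu.
rewrite (_ : (fun x => _) = fun x => \sum_j l j (u x) *: L x (e j)).
  by apply: Ck_sum => // j; apply: Ck_scale => //; exact: Ck_linear.
apply/funext => x; rewrite [in LHS](ls (u x)) linear_sum.
by apply: eq_bigr => j _; rewrite linearZ.
Qed.

(** By induction on the order: the differential of the composite at [v] is 'd g (f x) ('d f x v),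
    which [Ck_apply] handles, its hypothesis on fixed vectors being the induction hypothesis for the
    derivatives of [g]. *)
Lemma Ck_comp V V' W m (e : 'I_m -> V') (l : 'I_m -> {linear V' -> R})
    k (U : set V) (U' : set V') (f : V -> V') (g : V' -> W) :
  coordinates e l -> open U -> (forall x, U x -> U' (f x)) ->
  Ck k U f -> Ck k U' g -> Ck k U (g \o f).
Proof.
move=> el oU UU'; elim: k f g UU' => [|k IH] f g UU'.
  move=> hf hg x Ux; apply: continuous_comp; first exact: hf.
  by apply: hg; exact: UU'.
move=> cf [g1 g2]; have [f1 f2] := cf; split=> [x Ux|v].
  by apply: differentiable_comp; [exact: f1|apply: g1; exact: UU'].
apply: (@eq_Ck _ _ _ _ (fun x => 'd g (f x) ('d f x v))) => //.
  move=> x Ux.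
  by have -> := congr1 (@^~ v) (diff_comp (f1 x Ux) (g1 _ (UU' x Ux))).
apply: (Ck_apply (L := fun x => 'd g (f x)) el) => [//|w|]; last exact: f2.
by apply: (IH _ (fun y => 'd g y w) UU'); [exact: CkW|exact: g2].
Qed.

Definition rVcoord n (j : 'I_n) (u : 'rV[R]_n) : R := u 0 j.

Lemma rVcoord_is_linear n (j : 'I_n) : linear (rVcoord j).
Proof. by move=> a u v; rewrite /rVcoord !mxE. Qed.

HB.instance Definition _ n (j : 'I_n) :=
  GRing.isLinear.Build R 'rV[R]_n R *:%R (rVcoord j) (rVcoord_is_linear j).

Lemma coordinates_rV n :
  coordinates (fun j => delta_mx 0 j : 'rV[R]_n) (fun j => rVcoord j).
Proof.
split=> [j u|u]; first exact: coord_continuous.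
by rewrite [LHS]row_sum_delta.
Qed.

Lemma coordinates_R : coordinates (fun _ : 'I_1 => 1 : R) (fun _ => idfun).
Proof.
split=> [j u|u]; first exact: cvg_id.
by rewrite big_ord1 /= [RHS]mulr1.
Qed.

Lemma Ck_rV V n k (U : set V) (f : V -> 'rV[R]_n) : open U ->
  Ck k U f <-> forall j, Ck k U (fun x => f x 0 j : R).
Proof.
move=> oU; have [lc ls] := coordinates_rV n.
split=> [h j|h].
  exact: (@Ck_linear _ _ _ _ _ (rVcoord j) _ oU (lc j) h).
rewrite (_ : f = fun x => \sum_j f x 0 j *: delta_mx 0 j).
  by apply: Ck_sum => // j; apply: Ck_scale => //; exact: Ck_cst.
by apply/funext => x; exact: ls.
Qed.

End CkTheory.

(** * A bump function *)

Section Flat.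
Context {R : realType}.
Implicit Type P : {poly R}.

(** The polynomial parameter makes this family closed under differentiation, so that one induction
    gives all orders of smoothness at once. *)
Definition flat P (t : R) : R := if 0 < t then P.[t^-1] * expR (- t^-1) else 0.

(** Term by term, s^i <= i! e^s for s >= 0, from the exponential series. *)
Lemma horner_le_expR P :
  exists2 C, 0 <= C & forall s, 0 <= s -> `|P.[s]| <= C * expR s.
Proof.
exists (\sum_(i < size P) `|P`_i| * (i`!)%:R).
  by apply: sumr_ge0 => i _; rewrite mulr_ge0.
move=> s s0; rewrite horner_coef mulr_suml.
apply: (le_trans (ler_norm_sum _ _ _)); apply: ler_sum => i _.
rewrite normrM -mulrA ler_wpM2l// normrX (ger0_norm s0).
case: (nat_of_ord i) => [|j].
  by rewrite expr0 fact0 mul1r -expR0 ler_expR.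
have := expR_ge1Dxn j s0 => h.
rewrite mulrC -ler_pdivrMr ?ltr0n ?fact_gt0//.
by apply: le_trans h; rewrite lerDr.
Qed.

(* Being O(t^2) makes [flat P] differentiable at 0, with derivative 0. *)
Lemma flat_le P : exists2 C, 0 < C & forall t, `|flat P t| <= C * `|t| ^+ 2.
Proof.
(* The extra factor X^2, evaluated at 1/t, is what leaves t^2 in the bound; below, [C + 1] makes the
   constant positive, as is needed to divide by it. *)
have [C C0 hC] := horner_le_expR ('X^2 * P).
exists (C + 1); first by rewrite ltr_wpDl.
move=> t; rewrite /flat; case: ifPn => [t0|_]; last first.
  by rewrite normr0 mulr_ge0 ?exprn_ge0 // addr_ge0.
have := hC t^-1; rewrite invr_ge0 (ltW t0) => /(_ isT).
rewrite hornerM hornerXn normrM normrX (gtr0_norm t0).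
rewrite gtr0_norm ?invr_gt0// => h.
rewrite normrM (ger0_norm (expR_ge0 _)) expRN.
rewrite ler_pdivrMr ?expR_gt0//.
have t2 : 0 < t ^+ 2 by rewrite exprn_gt0.
rewrite -(ler_pM2l (x := t^-1 ^+ 2)) ?exprn_gt0 ?invr_gt0//.
apply: le_trans h _.
have -> : t^-1 ^+ 2 * ((C + 1) * t ^+ 2 * expR t^-1) = (C + 1) * expR t^-1.
  by field; rewrite gt_eqF.
by rewrite ler_wpM2r ?expR_ge0// lerDl.
Qed.

(** With s = 1/t one has ds/dt = - s^2, so P(s) e^{-s} has t-derivative s^2 (P - P')(s) e^{-s}. *)
Definition flat' P := 'X^2 * (P - P^`()).

Lemma is_derive_flat_gt0 P (t : R) :
  0 < t -> is_derive t 1 (flat P) (flat (flat' P) t).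
Proof.
move=> t0.
apply: (@near_eq_is_derive R R R (fun t : R => P.[t^-1] * expR (- t^-1))
  (flat P) t 1).
  near=> s; rewrite /flat ifT//; near: s; exact: lt_nbhsr.
have tn0 : t != 0 by rewrite gt_eqF.
have d1 : is_derive t 1 (fun s : R => s^-1) (- t ^- 2).
  have := is_deriveV tn0 (is_derive_id t 1).
  by rewrite [_ *: _]mulr1.
have d2 := is_derive1_comp (is_derive_poly P t^-1) d1.
have d3 := is_derive1_comp (g := - [eta GRing.inv]) (is_derive_expR (- t^-1))
  (is_deriveN d1).
have d := is_deriveM d2 d3.
apply: (is_derive_eq d).
rewrite /flat t0 /flat' !hornerE /= -![_ *: _]/(_ * _).
by field.
Unshelve. all: by end_near. Qed.

Lemma is_derive_flat P (t : R) : is_derive t 1 (flat P) (flat (flat' P) t).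
Proof.
have flat0 Q : flat Q 0 = 0 by rewrite /flat ltxx.
have [t0|t0|<-] := ltgtP 0 t; first exact: is_derive_flat_gt0.
  apply: (@near_eq_is_derive R R R (cst 0) (flat P) t 1).
    near=> s; rewrite /flat ifF//; apply/negbTE; rewrite -leNgt ltW//.
    by near: s; exact: lt_nbhsl.
  by rewrite /flat ltNge (ltW t0) /=; exact: is_derive_cst.
rewrite flat0.
have [C C0 hC] := flat_le P.
(* By [flat_le] the difference quotient at 0 is at most C |h| in absolute value. *)
have lim0 : h^-1 *: (flat P (h *: 1 + 0) - flat P 0) @[h --> 0^'] --> (0 : R).
  apply/cvgr0Pnorm_le => e e0; near=> h.
  rewrite flat0 subr0 addr0 [h *: 1]mulr1 normrM normfV.
  have hn0 : h != 0 by near: h; exact: nbhs_dnbhs_neq.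
  rewrite ler_pdivrMl ?normr_gt0//; apply: le_trans (hC h) _.
  rewrite expr2 mulrA mulrC ler_wpM2l// -ler_pdivlMl// mulrC ltW//.
  by near: h; apply: dnbhs0_lt; rewrite divr_gt0.
by apply: DeriveDef; [exact: cvgP lim0|exact: cvg_lim lim0].
Unshelve. all: by end_near. Qed.

Lemma Ck_flat P k (U : set R) : Ck k U (flat P).
Proof.
have df Q t : differentiable (flat Q) t.
  by apply/derivable1_diffP; have [] := is_derive_flat Q t.
(* The set [U] is arbitrary, whereas [Ck_scale] needs an open one. *)
apply: (@Ck_sub _ _ _ _ setT) => //.
elim: k P => [|k IH] P; first by move=> x _; exact: differentiable_continuous.
split=> [x _|v]; first exact: df.
rewrite (_ : (fun x => _) = fun x => v *: flat (flat' P) x).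
  by apply: Ck_scale; [exact: openT|exact: Ck_cst|exact: IH].
apply/funext => x; rewrite diff1E //; congr (_ *: _).
by rewrite derive1E; have [_ ->] := is_derive_flat P x.
Qed.

Lemma Ck_bump_rV n (a : 'rV[R]_n) (e : R) : 0 < e ->
  exists b : 'rV[R]_n -> R, [/\ forall k U, open U -> Ck k U b, b a != 0 &
    forall x, b x != 0 -> `|x - a| <= e].
Proof.
move=> e0.
(* The norm of ['rV[R]_n] is the sup norm, which is not smooth in general; the Euclidean square is.
   Positivity of [q] bounds every |x_j - a_j| by [e], hence also the sup norm. *)
pose q (x : 'rV[R]_n) : R :=
  e ^+ 2 + (-1) *: \sum_j (x 0 j - a 0 j) *: (x 0 j - a 0 j).
exists (flat 1 \o q); split.
- move=> k U oU.
  have cD j : Ck k U (fun x : 'rV[R]_n => x 0 j - a 0 j : R).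
    apply: Ck_add => //; last exact: Ck_cst.
    have cid : Ck k U (fun x : 'rV[R]_n => x).
      have idc : continuous (idfun : 'rV[R]_n -> 'rV[R]_n).
        by move=> x; exact: cvg_id.
      case: k => [|k]; first by move=> x _; exact: idc.
      split=> [x _|v]; first exact: ex_diff.
      rewrite (_ : (fun x => _) = fun=> v); first exact: Ck_cst.
      by apply/funext => x; rewrite diff_val.
    exact: (iffLR (Ck_rV k _ oU) cid j).
  apply: (Ck_comp (U' := setT) coordinates_R) => //; last exact: Ck_flat.
  apply: Ck_add => //; first exact: Ck_cst.
  apply: Ck_scale => //; first exact: Ck_cst.
  by apply: Ck_sum => // j; exact: Ck_scale.
- rewrite /= (_ : q a = e ^+ 2); last first.
    by rewrite /q big1 ?scaler0 ?addr0// => j _; rewrite subrr scaler0.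
  by rewrite /flat exprn_gt0// hornerE mul1r gt_eqF// expR_gt0.
- move=> x; rewrite /= /flat; case: ifPn => [q0 _|]; last by rewrite eqxx.
  rewrite [leLHS]/Num.Def.normr/= mx_normrE.
  rewrite (bigmax_le _ (ltW e0))//= => -[i j] _.
  rewrite ord1 !mxE -(ler_pXn2r (n := 2)) ?nnegrE ?(ltW e0)//.
  rewrite -normrX ger0_norm ?sqr_ge0//; apply/ltW; move: q0.
  rewrite /q scaleN1r subr_gt0; apply: le_lt_trans.
  rewrite (bigD1 j)//= [leRHS]addrC expr2 lerDr.
  by apply: sumr_ge0 => l _; have := sqr_ge0 (x 0 l - a 0 l); rewrite expr2.
Qed.

End Flat.

(** * Charts and the chain rule *)

Section Charts.
Context {R : realType} {n : nat} {T : topologicalType}.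
Implicit Types (c : chart R n T) (U : set T).

Lemma mem_cimg c U q : cdom c q -> U q -> (cmap c @` (cdom c `&` U)) (cmap c q).
Proof. by move=> cq Uq; exists q. Qed.

Lemma cimgP c U x : (cmap c @` (cdom c `&` U)) x ->
  [/\ cdom c (cinv c x), U (cinv c x) & cmap c (cinv c x) = x].
Proof. by move=> [q [cq Uq] <-]; rewrite cmapK. Qed.

(** Around each of its points this image contains the intersection of the open image of the chart
    with the preimage of [U] under [cinv], which is continuous there. *)
Lemma open_cimg c U : open U -> open (cmap c @` (cdom c `&` U)).
Proof.
move=> oU; rewrite openE => _ [q [cq Uq] <-].
have cqi : (cmap c @` cdom c) (cmap c q) by exists q.
have n1 : nbhs (cmap c q) (cmap c @` cdom c).
  by apply: open_nbhs_nbhs; split=> //; exact: cimg_open.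
have n2 : nbhs (cmap c q) (cinv c @^-1` U).
  have := cinv_continuous cqi; rewrite /prop_for /continuous_at cmapK//; apply.
  by apply: open_nbhs_nbhs; split.
rewrite /interior; apply: filterS2 n1 n2 => x [r cr <-] /=.
by rewrite cmapK// => Ur; exists r.
Qed.

Lemma near_cimg c U q : open U -> cdom c q -> U q ->
  \forall x \near cmap c q, (cmap c @` (cdom c `&` U)) x.
Proof.
move=> oU cq Uq; apply: open_nbhs_nbhs; split; first exact: open_cimg.
exact: mem_cimg.
Qed.

End Charts.

Section Manifolds.
Context {R : realType}.

Lemma smooth_map_id n (M : manifold R n) : smooth_map (@id M).
Proof. by split=> [x|p q]; [exact: cvg_id|exact: chart_compat]. Qed.

Lemma smooth_map_differentiable m n (M : manifold R m) (N : manifold R n)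
    (F : M -> N) (p : M) (q : N) (s : M) : smooth_map F ->
  cdom (chart_at p) s -> cdom (chart_at q) (F s) ->
  differentiable (cmap (chart_at q) \o F \o cinv (chart_at p))
    (cmap (chart_at p) s).
Proof.
by move=> [_ sF] ps qFs; have [h _] := sF p q 1%N; apply: h; exists s.
Qed.

(** The chain rule through an intermediate chart. The inserted [cinv] and [cmap] cancel only where
    [F] lands in the domain of that chart, which is why [near_eq_diff] is called on. *)
Lemma diff_chart_comp m n (M : manifold R m) (N : manifold R n)
    (W : normedModType R) (F : M -> N) (f : N -> W) (p : M) (q : N) (s : M) :
  smooth_map F ->
  cdom (chart_at p) s -> cdom (chart_at q) (F s) ->
  differentiable (f \o cinv (chart_at q)) (cmap (chart_at q) (F s)) ->
  differentiable (f \o F \o cinv (chart_at p)) (cmap (chart_at p) s) /\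
  forall v, 'd (f \o F \o cinv (chart_at p)) (cmap (chart_at p) s) v =
    'd (f \o cinv (chart_at q)) (cmap (chart_at q) (F s))
      ('d (cmap (chart_at q) \o F \o cinv (chart_at p))
        (cmap (chart_at p) s) v).
Proof.
move=> sF ps qFs df.
set G := cmap (chart_at q) \o F \o cinv (chart_at p); set x := cmap _ s.
have dG : differentiable G x by exact: smooth_map_differentiable.
have Gx : G x = cmap (chart_at q) (F s) by rewrite /G /x /= cmapK.
rewrite -Gx in df *.
have E : \near x, ((f \o cinv (chart_at q)) \o G) x =
  (f \o F \o cinv (chart_at p)) x.
  have oU : open (F @^-1` cdom (chart_at q)).
    by apply: open_comp => [y _|]; [exact: sF.1|exact: cdom_open].
  near=> y.
  have /cimgP[_ /= qFy _] : (cmap (chart_at p) @`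
      (cdom (chart_at p) `&` F @^-1` cdom (chart_at q))) y.
    by near: y; exact: near_cimg.
  by rewrite /G /= cmapK.
have [d1 d2] := near_eq_diff E (differentiable_comp dG df).
by split=> // v; rewrite d2; have -> := congr1 (@^~ v) (diff_comp dG df).
Unshelve. all: by end_near. Qed.

Lemma diff_chartK n (M : manifold R n) (p s : M) v : cdom (chart_at p) s ->
  'd (cmap (chart_at p) \o cinv (chart_at p)) (cmap (chart_at p) s) v = v.
Proof.
move=> ps.
have E : \forall y \near cmap (chart_at p) s, id y =
  (cmap (chart_at p) \o cinv (chart_at p)) y.
  near=> y.
  have /cimgP[_ _ yE] : (cmap (chart_at p) @` (cdom (chart_at p) `&` setT)) y.
    by near: y; apply: near_cimg => //; exact: openT.
  by rewrite /= yE.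
have di : is_diff (cmap (chart_at p) s) id id := is_diff_id _.
have [_ d] := near_eq_diff E (@ex_diff _ _ _ _ _ _ _ di).
by rewrite d (@diff_val _ _ _ _ _ _ _ di).
Unshelve. all: by end_near. Qed.

Lemma diff_chart_chain n (M : manifold R n) (p q r s : M) v :
  cdom (chart_at p) s -> cdom (chart_at q) s -> cdom (chart_at r) s ->
  'd (cmap (chart_at r) \o cinv (chart_at p)) (cmap (chart_at p) s) v =
  'd (cmap (chart_at r) \o cinv (chart_at q)) (cmap (chart_at q) s)
    ('d (cmap (chart_at q) \o cinv (chart_at p)) (cmap (chart_at p) s) v).
Proof.
move=> ps qs rs.
have dr : differentiable (cmap (chart_at r) \o cinv (chart_at q))
    (cmap (chart_at q) s).
  exact: (@smooth_map_differentiable _ _ _ _ (@id M) q r s (smooth_map_id M)).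
have [_] := @diff_chart_comp _ _ _ _ _ (@id M) (cmap (chart_at r)) p q s
  (smooth_map_id M) ps qs dr.
have compid (T : Type) (f : M -> T) : f \o @id M = f by [].
by rewrite !compid; exact.
Qed.

(** Both sides factor the differential of [F] read from the chart at [s] to the chart at [q]: one
    through the chart at [F s] on the target, the other through the chart at [p] on the source. *)
Lemma coord_change_tangent_map m n (M : manifold R m) (N : manifold R n)
    (F : M -> N) (p : M) (q : N) (s : M) v : smooth_map F ->
  cdom (chart_at p) s -> cdom (chart_at q) (F s) ->
  coord_change q (F s) (tangent_map F s v) =
  'd (cmap (chart_at q) \o F \o cinv (chart_at p)) (cmap (chart_at p) s)
    (coord_change p s v).
Proof.
move=> sF ps qFs.
have d1 : differentiable (cmap (chart_at q) \o cinv (chart_at (F s)))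
    (cmap (chart_at (F s)) (F s)).
  apply: (@smooth_map_differentiable _ _ _ _ (@id N) (F s) q (F s)
    (smooth_map_id N)) => //.
  exact: mem_chart_at.
have [_ h1] := diff_chart_comp sF (mem_chart_at s) (mem_chart_at (F s)) d1.
have d2 := smooth_map_differentiable sF ps qFs.
have [_ h2] := @diff_chart_comp _ _ _ _ _ (@id M) (cmap (chart_at q) \o F)
  s p s (smooth_map_id M) (mem_chart_at s) ps d2.
have compid (T : Type) (f : M -> T) : f \o @id M = f by [].
by rewrite /coord_change /tangent_map -h1; move: (h2 v); rewrite !compid; exact.
Qed.

Lemma dirder_comp m n (M : manifold R m) (N : manifold R n)
    (F : M -> N) (f : N -> R) (s : M) v : smooth_map F -> smooth_fun f ->
  differentiable (f \o F \o cinv (chart_at s)) (cmap (chart_at s) s) /\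
  dirder (f \o F) s v = dirder f (F s) (tangent_map F s v).
Proof.
move=> sF sf.
have df : differentiable (f \o cinv (chart_at (F s)))
    (cmap (chart_at (F s)) (F s)).
  have [h _] := sf (F s) 1%N; apply: h; exists (F s) => //; exact: mem_chart_at.
have [h1 h2] := diff_chart_comp sF (mem_chart_at s) (mem_chart_at (F s)) df.
by split; [exact: h1|exact: h2].
Qed.

End Manifolds.

(** * Smooth functions and sections *)

Section ChartSmooth.
Context {R : realType}.

(** Smoothness read in a single source chart, with values in any normed space: the common form to
    which functions and, through [coord_change], fields are reduced. *)
Definition chart_smooth n (M : manifold R n) (W : normedModType R) (p : M)
    (U : set M) (f : M -> W) : Prop :=
  smooth_on (cmap (chart_at p) @` (cdom (chart_at p) `&` U))
    (f \o cinv (chart_at p)).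

Section Operations.
Context {n : nat} {M : manifold R n} {W : normedModType R}.
Implicit Types (p : M) (U : set M) (f g : M -> W).

Lemma eq_chart_smooth p U f g : open U ->
  (forall q, cdom (chart_at p) q -> U q -> f q = g q) ->
  chart_smooth p U f -> chart_smooth p U g.
Proof.
move=> oU fg sf k; apply: eq_Ck (sf k); first exact: open_cimg.
by move=> _ [q [pq Uq] <-] /=; rewrite cmapK ?fg.
Qed.

Lemma chart_smooth_sub p U U' f : U' `<=` U ->
  chart_smooth p U f -> chart_smooth p U' f.
Proof.
move=> UU sf k; apply: Ck_sub (sf k).
by move=> _ [q [pq Uq] <-]; exists q => //; split=> //; exact: UU.
Qed.

Lemma chart_smooth_local p U f :
  (forall q, cdom (chart_at p) q -> U q ->
    exists2 U' : set M, U' q & chart_smooth p U' f) ->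
  chart_smooth p U f.
Proof.
move=> h k; apply: Ck_local => _ [q [pq Uq] <-].
have [U' U'q sf] := h q pq Uq.
by exists (cmap (chart_at p) @` (cdom (chart_at p) `&` U'));
  [exists q|exact: sf].
Qed.

Lemma chart_smooth_cst p U (c : W) : chart_smooth p U (fun=> c).
Proof. by move=> k; exact: Ck_cst. Qed.

Lemma chart_smooth_add p U f g : open U ->
  chart_smooth p U f -> chart_smooth p U g ->
  chart_smooth p U (fun q => f q + g q).
Proof.
by move=> oU sf sg k; apply: Ck_add; [exact: open_cimg|exact: sf|exact: sg].
Qed.

Lemma chart_smooth_scale p U (h : M -> R) g : open U ->
  chart_smooth p U h -> chart_smooth p U g ->
  chart_smooth p U (fun q => h q *: g q).
Proof.
by move=> oU sf sg k; apply: Ck_scale; [exact: open_cimg|exact: sf|exact: sg].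
Qed.

End Operations.

Lemma chart_smooth_comp m n (M : manifold R m) (N : manifold R n)
    (W : normedModType R) (F : M -> N) (f : N -> W) (U : set N) p q :
  smooth_map F -> open U -> chart_smooth q U f ->
  chart_smooth p (F @^-1` (cdom (chart_at q) `&` U)) (f \o F).
Proof.
move=> [cF sF] oU sf k.
have oF (A : set N) : open A -> open (F @^-1` A).
  by move=> oA; apply: open_comp => // x _; exact: cF.
have oD : open (F @^-1` (cdom (chart_at q) `&` U)).
  by apply: oF; apply: openI => //; exact: cdom_open.
apply: (@eq_Ck _ _ _ _ _ ((f \o cinv (chart_at q)) \o
  (cmap (chart_at q) \o F \o cinv (chart_at p)))).
- exact: open_cimg.
- by move=> _ [r [pr [qr Ur]] <-] /=; rewrite (cmapK pr) cmapK.
- apply: (Ck_comp (coordinates_rV _) _ _ _ (sf k)).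
  + exact: open_cimg.
  + by move=> _ [r [pr [qr Ur]] <-] /=; rewrite (cmapK pr); exists (F r).
  + by apply: Ck_sub (sF p q k) => _ [r [pr [qr Ur]] <-]; exists r.
Qed.

Lemma smooth_funP n (M : manifold R n) (f : M -> R) :
  smooth_fun f <-> forall p, chart_smooth p setT f.
Proof. by split=> h p; move: (h p); rewrite /chart_smooth setIT. Qed.

Lemma smooth_field_alongP m n (M : manifold R m) (N : manifold R n) U
    (F : M -> N) V :
  smooth_field_along U F V <->
  forall p q, chart_smooth p (U `&` F @^-1` cdom (chart_at q))
    (fun r => coord_change q (F r) (V r)).
Proof.
by split=> h p q; move: (h p q); rewrite /chart_smooth setIA.
Qed.

Lemma smooth_fun_cst n (M : manifold R n) (c : R) : smooth_fun (fun _ : M => c).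
Proof. by apply/smooth_funP => p; exact: chart_smooth_cst. Qed.

Lemma smooth_fun_mul n (M : manifold R n) (f g : M -> R) :
  smooth_fun f -> smooth_fun g -> smooth_fun (fun q => f q * g q).
Proof.
move=> /smooth_funP sf /smooth_funP sg; apply/smooth_funP => p.
by apply: chart_smooth_scale => //; exact: openT.
Qed.

Lemma smooth_fun_comp m n (M : manifold R m) (N : manifold R n) (F : M -> N) f :
  smooth_map F -> smooth_fun f -> smooth_fun (f \o F).
Proof.
move=> sF /smooth_funP sf; apply/smooth_funP => p.
apply: chart_smooth_local => q pq _.
exists (F @^-1` (cdom (chart_at (F q)) `&` setT));
  last exact: chart_smooth_comp openT (sf _).
by split=> //; exact: mem_chart_at.
Qed.

Section Sections.
Context {m n : nat} {M : manifold R m} {N : manifold R n} {F : M -> N}.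
Hypothesis sF : smooth_map F.
Implicit Types V W : M -> 'rV[R]_n.

Lemma open_preimage (A : set N) : open A -> open (F @^-1` A).
Proof. by move=> oA; apply: open_comp => // x _; exact: sF.1. Qed.

Let oD q : open (setT `&` F @^-1` cdom (chart_at q)).
Proof. by rewrite setTI; apply: open_preimage; exact: cdom_open. Qed.

Lemma section_add V W : sections_along F V -> sections_along F W ->
  sections_along F (fun r => V r + W r).
Proof.
move=> /smooth_field_alongP sV /smooth_field_alongP sW.
apply/smooth_field_alongP => p q.
apply: eq_chart_smooth (chart_smooth_add (oD q) (sV p q) (sW p q)) => // r _ _.
by rewrite /coord_change linearD.
Qed.

Lemma section_scale f V : smooth_fun f -> sections_along F V ->
  sections_along F (fun r => f r *: V r).
Proof.
move=> /smooth_funP sf /smooth_field_alongP sV.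
apply/smooth_field_alongP => p q.
apply: eq_chart_smooth (chart_smooth_scale (oD q) _ (sV p q)) => //; last first.
  exact: chart_smooth_sub (sf p).
by move=> r _ _; rewrite /coord_change linearZ.
Qed.

Lemma section0 : sections_along F (fun=> 0).
Proof.
apply/smooth_field_alongP => p q.
apply: eq_chart_smooth (chart_smooth_cst _ _ 0) => // r _ _.
by rewrite /coord_change linear0.
Qed.

Lemma section_sum (I : Type) (s : seq I) (P : pred I) (V : I -> M -> 'rV[R]_n) :
  (forall i, sections_along F (V i)) ->
  sections_along F (fun r => \sum_(i <- s | P i) V i r).
Proof.
move=> sV; elim: s => [|i s IH].
  by under [X in sections_along _ X]funext do rewrite big_nil; exact: section0.
rewrite (_ : (fun r => _) = fun r =>
    (if P i then V i r else 0) + \sum_(i <- s | P i) V i r).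
  by apply: section_add => //; case: (P i); [exact: sV|exact: section0].
by apply/funext => r; rewrite big_cons; case: (P i); rewrite ?add0r.
Qed.

Lemma section_comp (Z : N -> 'rV[R]_n) : vector_fields N Z ->
  sections_along F (Z \o F).
Proof.
move=> /smooth_field_alongP sZ; apply/(smooth_field_alongP setT F) => p q.
have oU : open (setT `&` @id N @^-1` cdom (chart_at q)).
  by rewrite setTI; exact: cdom_open.
by apply: chart_smooth_sub (chart_smooth_comp p sF oU (sZ q q)) => r [_ qr].
Qed.

Lemma section_tangent_map (Y : M -> 'rV[R]_m) : vector_fields M Y ->
  sections_along F (fun r => tangent_map F r (Y r)).
Proof.
move=> /smooth_field_alongP sY; apply/smooth_field_alongP => p q k.
set G := cmap (chart_at q) \o F \o cinv (chart_at p).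
apply: (@eq_Ck _ _ _ _ _ (fun x => 'd G x
  (coord_change p (cinv (chart_at p) x) (Y (cinv (chart_at p) x))))).
- exact: open_cimg.
- move=> _ [r [pr [_ qr]] <-]; rewrite /= cmapK// -coord_change_tangent_map//.
- apply: (Ck_apply (L := fun x => 'd G x) (coordinates_rV _)).
  + exact: open_cimg.
  (* Differentiating [F] costs one order, so its smoothness is used at order k + 1. *)
  + move=> v; have [_ h] := sF.2 p q k.+1.
    by apply: Ck_sub (h v) => _ [r [pr [_ qr]] <-]; exists r.
  + by apply: Ck_sub (sY p p k) => _ [r [pr [_ qr]] <-]; exists r.
Qed.

End Sections.

End ChartSmooth.

(** * Cutoffs and extensions *)

Section Bump.
Context {R : realType}.

(** The closed set [K] serves for gluing: when [U] is open, [U] and the complement of [K] form an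
    open cover, and a cut-off object vanishes on the latter. Only [phi p != 0] is asked, since later
    arguments divide by this value. *)
Record bump n (M : manifold R n) (p : M) (U : set M) (phi : M -> R) := Bump {
  bump_smooth : smooth_fun phi;
  bump_neq0 : phi p != 0;
  bump_supp :
    exists K, [/\ closed K, K `<=` U & forall q, ~ K q -> phi q = 0] }.

(** A bump in the chart is transported and extended by 0. Its support lies in the image of a closed
    ball, which is compact and therefore closed because the manifold is Hausdorff. *)
Lemma bump_exists n (M : manifold R n) (p : M) (U : set M) : open U -> U p ->
  exists phi, bump p U phi.
Proof.
move=> oU Up; set c := chart_at p; have cp : cdom c p := mem_chart_at p.
have /nbhs_ballP[e /= e0 be] : nbhs (cmap c p) (cmap c @` (cdom c `&` U)).
  exact: near_cimg.
(* Half the radius keeps the closed ball inside the open ball contained in the chart image. *)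
have e20 : 0 < e / 2 by rewrite divr_gt0.
have [b [sb bp bsupp]] := Ck_bump_rV (cmap c p) e20.
pose B := [set x : 'rV[R]_n | `|x - cmap c p| <= e / 2].
have BU : B `<=` cmap c @` (cdom c `&` U).
  move=> x xB; apply: be; rewrite -ball_normE /= distrC.
  by apply: le_lt_trans xB _; rewrite ltr_pdivrMr// ltr_pMr// ltr1n.
have cB : compact B.
  apply: bounded_closed_compact.
    exists (`|cmap c p| + e / 2); split=> [|y yM x xB]; first exact: num_real.
    apply: ltW; apply: le_lt_trans yM.
    rewrite -[x](subrK (cmap c p)) addrC.
    by apply: le_trans (ler_normD _ _) _; rewrite lerD2l.
  rewrite (_ : B = closed_ball_ Num.norm (cmap c p) (e / 2)).
    exact: closed_closed_ball_.
  by apply/funext => x; rewrite /B /closed_ball_ /= distrC.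
pose K := cinv c @` B.
have clK : closed K.
  apply: (compact_closed (@carrier_hausdorff _ _ M)).
  apply: continuous_compact => //; apply: continuous_in_subspaceT => x.
  rewrite inE => /BU [q [cq Uq] <-]; apply: cinv_continuous; by exists q.
have KU : K `<=` cdom c `&` U.
  by move=> _ [x /BU [q cq <-] <-]; rewrite cmapK//; case: cq.
pose phi q := if `[< cdom c q >] then b (cmap c q) else 0.
have phi0 q : ~ K q -> phi q = 0.
  rewrite /phi; case: asboolP => // cq Kq; apply/eqP/negPn/negP => /bsupp xB.
  by apply: Kq; exists (cmap c q) => //; rewrite cmapK.
exists phi; split; last by exists K; split=> // q /KU[].
- apply/smooth_funP => r; apply: chart_smooth_local => q rq _.
  have [Kq|Kq] := pselect (K q); last first.
    exists (~` K) => //; apply: eq_chart_smooth (chart_smooth_cst _ _ 0).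
      exact: closed_openC.
    by move=> s _ /phi0.
  have [cq _] := KU q Kq; exists (cdom c) => //.
  have oc : open (cmap c @` (cdom c `&` setT)).
    by apply: open_cimg; exact: openT.
  have sbc : chart_smooth p setT (b \o cmap c).
    move=> k; apply: (eq_Ck oc _ (sb k _ oc)) => x /cimgP[_ _ xE].
    by rewrite /= xE.
  apply: eq_chart_smooth (chart_smooth_sub _ (chart_smooth_comp r
    (smooth_map_id M) openT sbc)).
  - exact: cdom_open.
  - by move=> s _ cs; rewrite /phi asboolT.
  - by move=> s cs; split.
- by rewrite /phi asboolT.
Qed.

(** The cutoff lives on the target: the preimages of [O] and of the complement of [K] cover [M]; on
    the first the product is smooth, on the second it is 0. *)
Lemma chart_smooth_cutoff m n (M : manifold R m) (N : manifold R n)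
    (W : normedModType R) (F : M -> N) (q : N) O phi (p : M) (U : set M)
    (f : M -> W) :
  smooth_map F -> open U -> open O -> bump q O phi ->
  chart_smooth p (U `&` F @^-1` O) f ->
  chart_smooth p U (fun r => phi (F r) *: f r).
Proof.
move=> sF oU oO [sphi _ [K [cK KO phi0]]] sf.
apply: chart_smooth_local => r pr Ur.
have [Kr|Kr] := pselect (K (F r)).
  exists (U `&` F @^-1` O); first by split=> //; exact: KO.
  apply: chart_smooth_scale => //.
    by apply: openI => //; exact: open_preimage.
  have /smooth_funP sphiF := smooth_fun_comp sF sphi.
  exact: chart_smooth_sub (sphiF p).
exists (F @^-1` ~` K) => //.
apply: eq_chart_smooth (chart_smooth_cst _ _ 0).
  by apply: open_preimage => //; exact: closed_openC.
by move=> s _ /phi0 ->; rewrite scale0r.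
Qed.

(* the field with constant components [v] in the chart [chart_at q] *)
Definition coord_field n (M : manifold R n) (q : M) (v : 'rV[R]_n) (s : M) :
    'rV[R]_n :=
  'd (cmap (chart_at s) \o cinv (chart_at q)) (cmap (chart_at q) s) v.

Lemma coord_change_field n (M : manifold R n) (p q s : M) v :
  cdom (chart_at p) s -> cdom (chart_at q) s ->
  coord_change p s (coord_field q v s) =
  'd (cmap (chart_at p) \o cinv (chart_at q)) (cmap (chart_at q) s) v.
Proof.
by move=> ps qs; rewrite [RHS](diff_chart_chain v qs (mem_chart_at s) ps).
Qed.

Lemma coord_fieldK n (M : manifold R n) (q s : M) v :
  cdom (chart_at q) s -> coord_field q (coord_change q s v) s = v.
Proof.
move=> qs; rewrite /coord_field /coord_change.
rewrite -(diff_chart_chain v (mem_chart_at s) qs (mem_chart_at s)).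
by rewrite diff_chartK//; exact: mem_chart_at.
Qed.

Lemma vector_field_cutoff n (M : manifold R n) (q : M) phi v :
  bump q (cdom (chart_at q)) phi ->
  vector_fields M (fun s => phi s *: coord_field q v s).
Proof.
move=> bphi; apply/(smooth_field_alongP setT (@id M)) => p r.
apply: (@eq_chart_smooth _ _ _ _ _ _
  (fun s => phi s *: coord_change r s (coord_field q v s))).
- by rewrite setTI; exact: cdom_open.
- by move=> s _ _; rewrite /coord_change linearZ.
apply: (chart_smooth_cutoff (smooth_map_id M) _ _ bphi).
- by rewrite setTI; exact: cdom_open.
- exact: cdom_open.
pose f s := 'd (cmap (chart_at r) \o cinv (chart_at q)) (cmap (chart_at q) s) v.
have sf : chart_smooth q (cdom (chart_at r)) f.
  (* The components in the chart at [r] are a directional derivative of a transition map, hence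
     order k + 1. *)
  move=> k; have [_ h] := chart_compat (m := M) q r k.+1.
  apply: eq_Ck (h v); first by apply: open_cimg; exact: cdom_open.
  by move=> _ [s [qs rs] <-]; rewrite /f /= cmapK.
have := chart_smooth_comp p (smooth_map_id M) (cdom_open _) sf.
move=> h; apply: eq_chart_smooth (chart_smooth_sub _ h).
- by rewrite setTI; apply: openI; exact: cdom_open.
- by move=> s ps [[_ rs] qs]; rewrite coord_change_field.
- by move=> s [[_ rs] qs].
Qed.

Lemma vector_field_extension n (M : manifold R n) (q : M) v :
  exists2 Y, vector_fields M Y & Y q = v.
Proof.
have [phi bphi] := bump_exists (cdom_open (chart_at q)) (mem_chart_at q).
exists (fun s => phi s *: coord_field q ((phi q)^-1 *: v) s).
  exact: vector_field_cutoff.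
rewrite /coord_field linearZ scalerA divff ?scale1r ?(bump_neq0 bphi)//.
by rewrite diff_chartK//; exact: mem_chart_at.
Qed.

(* [phi] is the square of a cutoff around [F p]: one factor extends the
   coordinate fields of a chart to [N], the other the components of [V] to
   [M]. *)
Lemma section_decomposition m n (M : manifold R m) (N : manifold R n)
    (F : M -> N) V (p : M) : smooth_map F -> sections_along F V ->
  exists (phi : M -> R) (h : 'I_n -> M -> R) (E : 'I_n -> N -> 'rV[R]_n),
    [/\ smooth_fun phi, phi p != 0, forall a, smooth_fun (h a),
        forall a, vector_fields N (E a) &
        forall r, \sum_a h a r *: E a (F r) = phi r *: V r].
Proof.
move=> sF /smooth_field_alongP sV; set q := F p.
have [phi bphi] := bump_exists (cdom_open (chart_at q)) (mem_chart_at q).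
have sphiF := smooth_fun_comp sF (bump_smooth bphi).
exists (fun r => phi (F r) * phi (F r)).
exists (fun a r => phi (F r) *: (coord_change q (F r) (V r)) 0 a).
exists (fun a s => phi s *: coord_field q (delta_mx 0 a) s).
split.
- exact: smooth_fun_mul.
- by rewrite mulf_neq0// (bump_neq0 bphi).
- move=> a; apply/smooth_funP => r.
  apply: (chart_smooth_cutoff sF openT (cdom_open _) bphi) => k.
  have oD : open (setT `&` F @^-1` cdom (chart_at q)).
    by rewrite setTI; apply: open_preimage => //; exact: cdom_open.
  exact: (iffLR (Ck_rV _ _ (open_cimg oD)) (sV r q k) a).
- by move=> a; exact: vector_field_cutoff.
- move=> r; have [qr|qr] := pselect (cdom (chart_at q) (F r)); last first.
    have [_ _ [K [_ KU ->]]] := bphi; last by move=> /KU.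
    by rewrite mul0r scale0r big1// => a _; rewrite !scale0r.
  set x := coord_change q (F r) (V r).
  have [_ ls] := coordinates_rV (R := R) n.
  rewrite -[V r in RHS](coord_fieldK (V r) qr) -/x [in RHS](ls x) /coord_field.
  rewrite linear_sum scaler_sumr; apply: eq_bigr => a _.
  rewrite [in RHS]linearZ /= !scalerA; congr (_ *: _); exact: mulrAC.
Qed.

End Bump.

(** * Duality along a map *)

Section Metric.
Context {R : realType} {n : nat} {N : manifold R n}
  {g : N -> 'rV[R]_n -> 'rV[R]_n -> R} (sg : semi_riemannian g).

Lemma metricDl p u v w : g p (u + v) w = g p u w + g p v w.
Proof. by have := metric_linear sg p 1 u v w; rewrite scale1r mul1r. Qed.

Lemma metric0l p w : g p 0 w = 0.
Proof. by apply: (@addrI _ (g p 0 w)); rewrite -metricDl !addr0. Qed.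

Lemma metricZl p a u w : g p (a *: u) w = a * g p u w.
Proof. by have := metric_linear sg p a u 0 w; rewrite addr0 metric0l addr0. Qed.

Lemma metricDr p w u v : g p w (u + v) = g p w u + g p w v.
Proof. by rewrite !(Defs.metric_sym sg p w) metricDl. Qed.

Lemma metricZr p a w u : g p w (a *: u) = a * g p w u.
Proof. by rewrite !(Defs.metric_sym sg p w) metricZl. Qed.

End Metric.

Section Duality.
Context {R : realType} {m n : nat} {M : manifold R m} {N : manifold R n}
  {F : M -> N} {g : N -> 'rV[R]_n -> 'rV[R]_n -> R}.
Hypotheses (sF : smooth_map F) (sg : semi_riemannian g).
Implicit Types (D : (M -> 'rV[R]_m) -> (M -> 'rV[R]_n) -> (M -> 'rV[R]_n))
  (X : M -> 'rV[R]_m) (V W : M -> 'rV[R]_n) (p : M).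

Definition pairing V W (q : M) : R := g (F q) (V q) (W q).

(* Differentiability is part of the invariant: ['d] is a junk value elsewhere,
   and the metric is only known to be smooth on pairs of ambient fields. *)
Definition dual_at D D' X V W p : Prop :=
  differentiable (pairing V W \o cinv (chart_at p)) (cmap (chart_at p) p) /\
  dirder (pairing V W) p (X p) =
    g (F p) (D X V p) (W p) + g (F p) (V p) (D' X W p).

Lemma pairing_sym V W : pairing V W = pairing W V.
Proof. by apply/funext => q; rewrite /pairing Defs.metric_sym. Qed.

Lemma dual_at_sym D D' X V W p : dual_at D D' X V W p -> dual_at D' D X W V p.
Proof.
rewrite /dual_at pairing_sym => -[h1 h2]; split=> //.
rewrite h2 addrC !(Defs.metric_sym sg (F p) (W p)).
by rewrite !(Defs.metric_sym sg (F p) (V p)).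
Qed.

Lemma smooth_fun_differentiable (f : M -> R) p : smooth_fun f ->
  differentiable (f \o cinv (chart_at p)) (cmap (chart_at p) p).
Proof.
move=> sf; have [h _] := sf p 1%N; apply: h; exists p => //.
exact: mem_chart_at.
Qed.

Section Left.
Variables (D D' : (M -> 'rV[R]_m) -> (M -> 'rV[R]_n) -> (M -> 'rV[R]_n)).
Hypothesis cD : connection_along F D.
Variables (X : M -> 'rV[R]_m) (W : M -> 'rV[R]_n) (p : M).
Hypothesis vX : vector_fields M X.

Let x := cmap (chart_at p) p.
Let xK : cinv (chart_at p) x = p.
Proof. by rewrite /x cmapK//; exact: mem_chart_at. Qed.

Lemma dual_at_add V V' : sections_along F V -> sections_along F V' ->
  dual_at D D' X V W p -> dual_at D D' X V' W p ->
  dual_at D D' X (fun q => V q + V' q) W p.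
Proof.
move=> sV sV' [d1 e1] [d2 e2].
have E : pairing (fun q => V q + V' q) W \o cinv (chart_at p) =
  (pairing V W \o cinv (chart_at p)) + (pairing V' W \o cinv (chart_at p)).
  by apply/funext => y; rewrite /= /pairing metricDl.
split; first by rewrite E; exact: differentiableD.
have -> : dirder (pairing (fun q => V q + V' q) W) p (X p) =
    dirder (pairing V W) p (X p) + dirder (pairing V' W) p (X p).
  by rewrite /dirder E; have -> := congr1 (@^~ (X p)) (diffD d1 d2).
rewrite e1 e2 (conn_addr cD vX sV sV') !metricDl //; ring.
Qed.

Lemma dual_at_scale f V : smooth_fun f -> sections_along F V ->
  dual_at D D' X V W p -> dual_at D D' X (fun q => f q *: V q) W p.
Proof.
move=> sf sV [d e].
have E : pairing (fun q => f q *: V q) W \o cinv (chart_at p) =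
  (fun y => (f \o cinv (chart_at p)) y *: (pairing V W \o cinv (chart_at p)) y).
  by apply/funext => y; rewrite /= /pairing metricZl.
have [h1 h2] := is_diff_scale (smooth_fun_differentiable p sf) d.
split; first by rewrite E.
have -> : dirder (pairing (fun q => f q *: V q) W) p (X p) =
    f p * dirder (pairing V W) p (X p) + dirder f p (X p) * pairing V W p.
  by rewrite {1}/dirder E h2 /= -/x xK.
rewrite e (conn_leibniz cD sf vX sV) metricDl// !metricZl// /pairing; ring.
Qed.

Lemma dual_at0 : dual_at D D' X (fun=> 0) W p.
Proof.
have E : pairing (fun=> 0) W \o cinv (chart_at p) = cst 0.
  by apply/funext => y; rewrite /= /pairing metric0l.
split; first by rewrite E; exact: differentiable_cst.
have -> : dirder (pairing (fun=> 0) W) p (X p) = 0.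
  by rewrite /dirder E diff_cst.
have h := conn_leibniz cD (@smooth_fun_cst _ _ M 0) vX (section0 sF).
have D0 : D X (fun=> 0) p = 0.
  rewrite [X in D _ X](_ : _ = fun=> 0 *: 0); last first.
    by apply/funext => q; rewrite scaler0.
  by rewrite h scaler0 scale0r addr0.
by rewrite D0 !metric0l// addr0.
Qed.

Lemma dual_at_sum (I : Type) (s : seq I) (V : I -> M -> 'rV[R]_n) :
  (forall i, sections_along F (V i)) -> (forall i, dual_at D D' X (V i) W p) ->
  dual_at D D' X (fun q => \sum_(i <- s) V i q) W p.
Proof.
move=> sV dV; elim: s => [|i s IH].
  rewrite (_ : (fun q => _) = fun=> 0); first exact: dual_at0.
  by apply/funext => q; rewrite big_nil.
rewrite (_ : (fun q => _) = fun q => V i q + \sum_(j <- s) V j q).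
  by apply: dual_at_add => //; exact: section_sum.
by apply/funext => q; rewrite big_cons.
Qed.

(** A converse to [dual_at_scale]. Near [p] the pairing is recovered by dividing by [f], which gives
    its differentiability; then the terms with the derivative of [f] cancel and the factor [f p] can
    be removed. *)
Lemma dual_at_cancel f V : smooth_fun f -> f p != 0 -> sections_along F V ->
  dual_at D D' X (fun q => f q *: V q) W p -> dual_at D D' X V W p.
Proof.
move=> sf fp sV [d e].
pose k := pairing V W \o cinv (chart_at p); pose f' := f \o cinv (chart_at p).
have E : pairing (fun q => f q *: V q) W \o cinv (chart_at p) =
    (fun y => f' y *: k y).
  by apply/funext => y; rewrite /= /pairing metricZl.
have df : differentiable f' x := smooth_fun_differentiable p sf.
have fx : f' x != 0 by rewrite /f' /= xK.
rewrite E in d.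
have dk : differentiable k x.
  have df' : differentiable (fun y => (f' y)^-1) x by exact: differentiableV.
  have [h _] := is_diff_scale df' d.
  apply: (near_eq_diff _ h).1.
  have f0 : \forall y \near x, f' y != 0.
    exact: (cvgr_neq0 _ (differentiable_continuous df)).
  by apply: filterS f0 => y f0; rewrite scalerA mulVf// scale1r.
split=> //.
have [_ h2] := is_diff_scale df dk.
apply: (mulfI fp).
have := e; rewrite {1}/dirder E h2 (conn_leibniz cD sf vX sV) metricDl//
  !metricZl//.
rewrite -[f' x]/(f (cinv _ x)) -[k x]/(pairing V W (cinv _ x)) xK /pairing.
rewrite -[_ *: _]/(f p * dirder (pairing V W) p (X p)).
rewrite -[X in _ + X = _]/(dirder f p (X p) * g (F p) (V p) (W p)) => h.
have := congr1 (fun z => z - dirder f p (X p) * g (F p) (V p) (W p)) h.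
by rewrite addrK => ->; ring.
Qed.

(** By [section_decomposition] a nonvanishing multiple of [V] is a combination of restricted ambient
    fields; [dual_at] passes to the combination and then to [V] by [dual_at_cancel]. *)
Lemma dual_at_section V :
  (forall Y, vector_fields N Y -> dual_at D D' X (Y \o F) W p) ->
  sections_along F V -> dual_at D D' X V W p.
Proof.
move=> dY sV; have [phi [h [E [sphi phip sh vE sumE]]]] :=
  section_decomposition p sF sV.
apply: dual_at_cancel phip sV _ => //.
rewrite (_ : (fun q => _) = fun r => \sum_a h a r *: (E a \o F) r).
  apply: dual_at_sum => a.
    by apply: section_scale => //; exact: section_comp.
  by apply: dual_at_scale => //; [exact: section_comp|exact: dY].
by apply/funext => r; rewrite sumE.
Qed.

End Left.

Lemma pullback_dual
    (nabla nabla' : (N -> 'rV[R]_n) -> (N -> 'rV[R]_n) -> (N -> 'rV[R]_n))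
    D D' X V W p : dual_connections g nabla nabla' ->
  pullback_connection F nabla D -> pullback_connection F nabla' D' ->
  vector_fields M X -> sections_along F V -> sections_along F W ->
  dual_at D D' X V W p.
Proof.
move=> dn [cD pD] [cD' pD'] vX sV sW.
have base Y Z : vector_fields N Y -> vector_fields N Z ->
    dual_at D D' X (Y \o F) (Z \o F) p.
  (* [Xb] need only agree with the image of [X] at the point [F p], since [pullback_connection]
     compares values pointwise. *)
  move=> vY vZ; have [Xb vXb Xbp] :=
    vector_field_extension (F p) (tangent_map F p (X p)).
  have sYZ := metric_smooth sg vY vZ.
  have [h1 h2] := dirder_comp p (X p) sF sYZ.
  split; first exact: h1.
  rewrite [LHS]h2 -Xbp (dn Xb Y Z vXb vY vZ).
  by rewrite (pD X Xb Y p)// (pD' X Xb Z p).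
(* The two arguments are reduced to ambient fields in turn; [dual_at_sym] brings the second to the
   left while exchanging [D] and [D']. *)
apply: dual_at_section => // Y vY; apply: dual_at_sym.
apply: dual_at_section => // Z vZ; apply: dual_at_sym; exact: base.
Qed.

End Duality.

(** * Lightlike hypersurfaces *)

(** Constant coefficients in a local frame, times a bump, give the section. It lets hypotheses about
    sections of the screen be tested on single vectors. *)
Lemma distribution_section (R : realType) n (M : manifold R n) r
    (S : M -> set 'rV[R]_n) (p : M) w : smooth_distribution r S -> S p w ->
  exists2 W, sections S W & W p = w.
Proof.
move=> dS Spw; have [U [E [oU Up sE SE]]] := dS p.
have [phi bphi] := bump_exists oU Up.
have [K [_ KU phi0]] := bump_supp bphi.
have := Spw; rewrite (SE p Up).2 => /submxP[c wE].
pose V q := \sum_j c 0 j *: E j q.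
have VE q : V q = c *m \matrix_(j < r) E j q.
  by rewrite mulmx_sum_row; apply: eq_bigr => j _; rewrite rowK.
exists (fun q => phi q *: ((phi p)^-1 *: V q)); last first.
  by rewrite scalerA divff ?(bump_neq0 bphi)// scale1r VE.
split=> [|q].
  apply/(smooth_field_alongP setT (@id M)) => q s.
  have oD : open (setT `&` @id M @^-1` cdom (chart_at s)).
    by rewrite setTI; exact: cdom_open.
  apply: (@eq_chart_smooth _ _ _ _ _ _
    (fun t => phi t *: ((phi p)^-1 *:
      \sum_j c 0 j *: coord_change s t (E j t)))).
  - exact: oD.
  - move=> t _ _; rewrite /coord_change [RHS]linearZ; congr (_ *: _).
    rewrite [RHS]linearZ; congr (_ *: _).
    by rewrite [RHS]linear_sum; apply: eq_bigr => j _; rewrite [RHS]linearZ.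
  apply: (chart_smooth_cutoff (smooth_map_id M) oD oU bphi).
  have oDU : open (setT `&` @id M @^-1` cdom (chart_at s) `&` @id M @^-1` U).
    exact: openI.
  apply: chart_smooth_scale => //; first exact: chart_smooth_cst.
  move=> k; apply: Ck_sum => [|j]; first exact: open_cimg.
  apply: Ck_scale; [exact: open_cimg|exact: Ck_cst|].
  have /smooth_field_alongP/(_ q s) := sE j; move=> /chart_smooth_sub h.
  by apply: h => t [[_ st] Ut].
have [Uq|Uq] := pselect (U q); last first.
  (* Away from [U] the value is 0, which lies in [S q] because [S] has a frame around [q] too. *)
  rewrite phi0 ?scale0r; last by move=> /KU.
  have [U' [E' [_ U'q _ SE']]] := dS q.
  by rewrite (SE' q U'q).2 sub0mx.
by rewrite (SE q Uq).2 VE !scalemx_sub// submxMl.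
Qed.

Section Lightlike.
Context {R : realType} {n : nat} {M : manifold R n} {Mb : manifold R n.+1}
  {gb : Mb -> 'rV[R]_n.+1 -> 'rV[R]_n.+1 -> R} {i : M -> Mb}.
Hypotheses (sgb : semi_riemannian gb) (si : smooth_map i).
Notation g := (induced_metric i gb).

Lemma tangent_mapD p u v :
  tangent_map i p (u + v) = tangent_map i p u + tangent_map i p v.
Proof. exact: linearD. Qed.

Lemma tangent_mapZ p a u : tangent_map i p (a *: u) = a *: tangent_map i p u.
Proof. exact: linearZ. Qed.

Lemma induced_metric_sym p u v : g p u v = g p v u.
Proof. exact: Defs.metric_sym sgb _ _ _. Qed.

Lemma induced_metricDl p u v w : g p (u + v) w = g p u w + g p v w.
Proof. by rewrite /induced_metric tangent_mapD metricDl. Qed.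

Lemma induced_metricZl p a u w : g p (a *: u) w = a * g p u w.
Proof. by rewrite /induced_metric tangent_mapZ metricZl. Qed.

Lemma induced_metricDr p u v w : g p w (u + v) = g p w u + g p w v.
Proof. by rewrite !(induced_metric_sym p w) induced_metricDl. Qed.

Lemma induced_metricZr p a u w : g p w (a *: u) = a * g p w u.
Proof. by rewrite !(induced_metric_sym p w) induced_metricZl. Qed.

Lemma Rad_lin p a b u v : Rad i gb p u -> Rad i gb p v ->
  Rad i gb p (a *: u + b *: v).
Proof.
move=> Ru Rv w.
by rewrite induced_metricDl !induced_metricZl Ru Rv !mulr0 addr0.
Qed.

Lemma vector_field_lin a b (X Y : M -> 'rV[R]_n) :
  vector_fields M X -> vector_fields M Y ->
  vector_fields M (fun p => a *: X p + b *: Y p).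
Proof.
have vZ c Z : vector_fields M Z -> vector_fields M (fun p => c *: Z p).
  by move=> vZ; exact: (section_scale (smooth_map_id M) (smooth_fun_cst c) vZ).
by move=> vX vY; exact: (section_add (smooth_map_id M) (vZ a X vX) (vZ b Y vY)).
Qed.

(** * The relation (D) and its consequences for radical fields *)

Section Gauss.
Context {nablab nablab' :
    (Mb -> 'rV[R]_n.+1) -> (Mb -> 'rV[R]_n.+1) -> (Mb -> 'rV[R]_n.+1)}
  {N : M -> 'rV[R]_n.+1}
  {Db Db' : (M -> 'rV[R]_n) -> (M -> 'rV[R]_n.+1) -> (M -> 'rV[R]_n.+1)}
  {nabla nabla' : (M -> 'rV[R]_n) -> (M -> 'rV[R]_n) -> (M -> 'rV[R]_n)}
  {B B' : (M -> 'rV[R]_n) -> (M -> 'rV[R]_n) -> (M -> R)}.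
Hypotheses (dual : dual_connections gb nablab nablab')
  (pD : pullback_connection i nablab Db)
  (pD' : pullback_connection i nablab' Db')
  (gD : gauss_formula i N Db nabla B) (gD' : gauss_formula i N Db' nabla' B').
Notation eta Z p := (gb (i p) (N p) (tangent_map i p (Z p))).

(** This is (D): [pullback_dual] applied to the images of [Y] and [Z] in the ambient tangent spaces,
    with both Gauss formulas substituted. *)
Lemma induced_dual X Y Z p :
  vector_fields M X -> vector_fields M Y -> vector_fields M Z ->
  dirder (fun q => g q (Y q) (Z q)) p (X p) =
    g p (nabla X Y p) (Z p) + B X Y p * eta Z p
    + (g p (Y p) (nabla' X Z p) + B' X Z p * eta Y p).
Proof.
move=> vX vY vZ.
have [_ e] := pullback_dual si sgb p dual pD pD' vX
  (section_tangent_map si vY) (section_tangent_map si vZ).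
rewrite [LHS]e; have [_ _ ->] := gD vX vY; have [_ _ ->] := gD' vX vZ.
rewrite metricDl// metricDr// metricZl// metricZr//.
by rewrite (Defs.metric_sym sgb (i p) (tangent_map i p (Y p)) (N p)).
Qed.

Lemma radical_dual X Y Z p :
  vector_fields M X -> sections (Rad i gb) Y -> vector_fields M Z ->
  g p (nabla X Y p) (Z p) = - B X Y p * eta Z p - B' X Z p * eta Y p.
Proof.
move=> vX [vY RY] vZ; have := induced_dual p vX vY vZ.
rewrite (_ : (fun q => _) = fun=> 0); last by apply/funext => q; exact: RY.
rewrite /dirder (_ : _ \o _ = cst 0)// diff_cst (RY p) add0r => h.
(* The differential of a constant is the zero map; [h0] restates its value as the scalar 0 by
   conversion. *)
have h0 : (0 : R) =
  g p (nabla X Y p) (Z p) + B X Y p * eta Z p + B' X Z p * eta Y p := h.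
lra.
Qed.

(** Placing the radical field in the second slot of (D) makes [nabla'] the connection that
    differentiates it. *)
Lemma radical_dual' X Y Z p :
  vector_fields M X -> sections (Rad i gb) Y -> vector_fields M Z ->
  g p (nabla' X Y p) (Z p) = - B' X Y p * eta Z p - B X Z p * eta Y p.
Proof.
move=> vX [vY RY] vZ; have := induced_dual p vX vZ vY.
rewrite (_ : (fun q => _) = fun=> 0); last first.
  by apply/funext => q; rewrite induced_metric_sym; exact: RY.
rewrite /dirder (_ : _ \o _ = cst 0)// diff_cst.
rewrite (induced_metric_sym p (nabla X Z p)) (RY p) add0r => h.
have h0 : (0 : R) =
  B X Z p * eta Y p + (g p (Z p) (nabla' X Y p) + B' X Y p * eta Z p) := h.
rewrite induced_metric_sym; lra.
Qed.

End Gauss.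
End Lightlike.

(** * The cycle of implications (1), (2), (3), (4), (1) *)

Theorem theorem3p1 (R : realType) (n : nat)
    (M : manifold R n) (Mb : manifold R n.+1)
    (gb : Mb -> 'rV[R]_n.+1 -> 'rV[R]_n.+1 -> R)
    (nablab nablab' :
      (Mb -> 'rV[R]_n.+1) -> (Mb -> 'rV[R]_n.+1) -> (Mb -> 'rV[R]_n.+1))
    (i : M -> Mb)
    (S : M -> set 'rV[R]_n)
    (xi : M -> 'rV[R]_n) (N : M -> 'rV[R]_n.+1)
    (Db Db' : (M -> 'rV[R]_n) -> (M -> 'rV[R]_n.+1) -> (M -> 'rV[R]_n.+1))
    (nabla nabla' : (M -> 'rV[R]_n) -> (M -> 'rV[R]_n) -> (M -> 'rV[R]_n))
    (B B' : (M -> 'rV[R]_n) -> (M -> 'rV[R]_n) -> (M -> R))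
    (A A' : (M -> 'rV[R]_n) -> (M -> 'rV[R]_n))
    (tau tau' : (M -> 'rV[R]_n) -> (M -> R)) :
  statistical_manifold gb nablab nablab' ->
  lightlike_hypersurface i gb ->
  screen_distribution i gb S ->
  radical_generator i gb xi ->
  lightlike_transversal i gb S xi N ->
  pullback_connection i nablab Db ->
  pullback_connection i nablab' Db' ->
  gauss_formula i N Db nabla B ->
  gauss_formula i N Db' nabla' B' ->
  radical_weingarten S xi nabla A tau ->
  radical_weingarten S xi nabla' A' tau' ->
  [<-> parallel nabla (Rad i gb) /\ parallel nabla' (Rad i gb);
       forall X, vector_fields M X -> forall p, A X p = 0 /\ A' X p = 0;
       metric_connection (induced_metric i gb) (mean_connection nabla nabla') /\
         (forall X, vector_fields M X ->
            sections (Rad i gb) (difference_tensor nabla nabla' X xi));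
       forall X W, vector_fields M X -> sections S W ->
         forall p, B X W p = 0 /\ B' X W p = 0].
Proof.
move=> stat [im _] screen [secxi xi0] trans pD pD' gD gD' wA wA'.
have sgb := stat_metric stat; have dual := stat_dual stat.
have si : smooth_map i := im.1.
have vxi : vector_fields M xi := secxi.1.
have Rxi p : Rad i gb p (xi p) := secxi.2 p.
pose eta p v := gb (i p) (N p) (tangent_map i p v).
have eta_xi p : eta p (xi p) = 1 by exact: transversal_radical trans p.
have eta_S p w : S p w -> eta p w = 0.
  by move=> Sw; exact: transversal_screen trans p w Sw.
have id2 X Y Z p vX vY vZ : _ = _ + B X Y p * eta p (Z p)
    + (_ + B' X Z p * eta p (Y p)) :=
  induced_dual sgb si dual pD pD' gD gD' p vX vY vZ.
have rd X Y Z p vX sY vZ :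
    _ = - B X Y p * eta p (Z p) - B' X Z p * eta p (Y p) :=
  radical_dual sgb si dual pD pD' gD gD' p vX sY vZ.
have rd' X Y Z p vX sY vZ :
    _ = - B' X Y p * eta p (Z p) - B X Z p * eta p (Y p) :=
  radical_dual' sgb si dual pD pD' gD gD' p vX sY vZ.
tfae.
(* (1) to (2): [A X] is a combination of the derivative of [xi] and [xi], hence radical; being also
   screen-valued, it is zero. *)
- move=> [par par'] X vX p.
  have A0 D A1 tau1 : radical_weingarten S xi D A1 tau1 ->
      parallel D (Rad i gb) -> A1 X p = 0.
    move=> wA1 parD; have [[_ SA] _ De] := wA1 X vX.
    have [_ RD] := parD X xi vX secxi.
    apply: (screen_direct screen _ (SA p)).
    have -> : A1 X p = (-1) *: D X xi p + (- tau1 X p) *: xi p.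
      by rewrite De scaleN1r scaleNr opprB opprK addrAC subrr add0r.
    exact: Rad_lin.
  by split; [exact: A0 wA par|exact: A0 wA' par'].
(* (2) to (3): the derivatives of [xi] are now multiples of [xi], so K(X, xi) is radical at once;
   metricity needs B + B' = 0. *)
- move=> A0.
  have RD D A1 tau1 X p : radical_weingarten S xi D A1 tau1 ->
      vector_fields M X -> A1 X p = 0 -> Rad i gb p (D X xi p).
    move=> wA1 vX A10; have [_ _ ->] := wA1 X vX.
    rewrite A10 oppr0 add0r -scaleNr -[X in Rad _ _ _ X]add0r -(scale0r (xi p)).
    exact: Rad_lin.
  have RX X p vX : Rad i gb p (nabla X xi p) :=
    RD _ _ _ X p wA vX (A0 X vX p).1.
  have RX' X p vX : Rad i gb p (nabla' X xi p) :=
    RD _ _ _ X p wA' vX (A0 X vX p).2.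
  split.
  + move=> X Y Z vX vY vZ p; rewrite /cov_deriv /mean_connection.
    rewrite !(induced_metricZl sgb, induced_metricDl sgb, induced_metricZr sgb,
      induced_metricDr sgb).
    (* With Y = xi the left-hand sides of [rd] and [rd'] vanish, which expresses B'(X, -) and B(X,
       -) as multiples of eta; evaluating at [xi] shows that the two multiples are opposite. *)
    have BB T : vector_fields M T -> B X T p + B' X T p = 0.
      have B'e T1 : vector_fields M T1 -> B' X T1 p = - B X xi p * eta p (T1 p).
        move=> vT; have := rd X xi T1 p vX secxi vT.
        by rewrite (RX X p vX) eta_xi; lra.
      have Be T1 : vector_fields M T1 -> B X T1 p = - B' X xi p * eta p (T1 p).
        move=> vT; have := rd' X xi T1 p vX secxi vT.
        by rewrite (RX' X p vX) eta_xi; lra.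
      move=> vT; rewrite (Be T vT) (B'e T vT) (Be xi vxi) eta_xi; ring.
    have e1 := id2 X Y Z p vX vY vZ; have e2 := id2 X Z Y p vX vZ vY.
    have e3 : dirder (fun q => induced_metric i gb q (Z q) (Y q)) p (X p) =
       dirder (fun q => induced_metric i gb q (Y q) (Z q)) p (X p).
      by congr (dirder _ p (X p)); apply/funext => q; exact: induced_metric_sym.
    rewrite e3 (induced_metric_sym sgb p (Z p)) in e2.
    rewrite (induced_metric_sym sgb p (nabla X Z p)) in e2.
    have bY' : B' X Y p = - B X Y p.
      by apply/eqP; rewrite -addr_eq0 addrC (BB Y vY).
    have bZ' : B' X Z p = - B X Z p.
      by apply/eqP; rewrite -addr_eq0 addrC (BB Z vZ).
    (* Half the sum of (D) and its exchanged form: the terms in [B] cancel. *)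
    rewrite bZ' in e1; rewrite bY' in e2; clear - e1 e2; lra.
  + move=> X vX; have [vD _ _] := gD X xi vX vxi.
    have [vD' _ _] := gD' X xi vX vxi.
    have E : difference_tensor nabla nabla' X xi =
        fun p => 2^-1 *: nabla X xi p + (- 2^-1) *: nabla' X xi p.
      by apply/funext => p; rewrite /difference_tensor scalerBr scaleNr.
    rewrite E; split; first exact: vector_field_lin.
    by move=> p; apply: Rad_lin; [exact: sgb|exact: RX|exact: RX'].
(* (3) to (4): metricity on (xi, W) kills the sum of g(nabla_X xi, W) and g(nabla'_X xi, W), the
   condition on K their difference. Since eta xi = 1 and eta W = 0, these two terms are - B'(X, W)
   and - B(X, W). *)
- move=> [mc rK] X W vX [vW SW] p.
  have := mc X xi W vX vxi vW p; have := (rK X vX).2 p (W p).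
  rewrite /cov_deriv /mean_connection /difference_tensor.
  have -> : dirder (fun q => induced_metric i gb q (xi q) (W q)) p (X p) = 0.
    rewrite (_ : (fun q => _) = fun=> 0); last by apply/funext => q; exact: Rxi.
    by rewrite /dirder (_ : _ \o _ = cst 0)// diff_cst.
  rewrite (Rxi p) -scaleN1r.
  rewrite !(induced_metricZl sgb, induced_metricDl sgb) => h1 h2.
  have := rd X xi W p vX secxi vW; have := rd' X xi W p vX secxi vW.
  rewrite eta_xi (eta_S p _ (SW p)) => e1 e2; split; lra.
- move=> B0.
  (* (4) to (1), for either connection: [B1] is its own form and [B2] that of its dual.
     Orthogonality to radical vectors is automatic; for a screen section W, eta W = 0 removes the
     [B1] term, and only B2(X, W) = 0 is needed. *)
  have par D B1 B2 Db1 : gauss_formula i N Db1 D B1 ->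
      (forall X W p, vector_fields M X -> sections S W -> B2 X W p = 0) ->
      (forall X Y Z p, vector_fields M X -> sections (Rad i gb) Y ->
        vector_fields M Z ->
        induced_metric i gb p (D X Y p) (Z p) =
        - B1 X Y p * eta p (Z p) - B2 X Z p * eta p (Y p)) ->
      parallel D (Rad i gb).
    move=> gD1 B20 rd1 X Y vX sY; have [vD _ _] := gD1 X Y vX sY.1.
    split=> // p v; have [u [w [Ru Sw ->]]] := screen_full screen p v.
    rewrite (induced_metricDr sgb) (induced_metric_sym sgb p _ u) Ru add0r.
    have [r dS] := screen_smooth screen.
    have [W sW Wp] := distribution_section dS Sw.
    rewrite -Wp (rd1 X Y W p vX sY sW.1) (B20 X W p vX sW) Wp (eta_S p w Sw).
    ring.
  split.
    by apply: (par _ _ _ _ gD _ rd) => X W p vX sW; exact: (B0 X W vX sW p).2.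
  by apply: (par _ _ _ _ gD' _ rd') => X W p vX sW; exact: (B0 X W vX sW p).1.
Qed.
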